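(* Let $n\ge 48$ and let $G$ be an $n$-vertex caterpillar with $r$ non-leaf vertices, where $r\ge (n-5)/2$, and whose non-leaf degrees $d_1\ge d_2\ge\cdots\ge d_r$ satisfy $d_1=d_3>d_4>2$. Then $G$ is reconstructible from its deck $\mathcal D(G)$: every graph $H$ with $\mathcal D(H)=\mathcal D(G)$ is isomorphic to $G$.
   Context: A caterpillar is a tree in which the subgraph induced by the non-leaf vertices is a path (the spine). For an $n$-vertex graph $G$, the deck $\mathcal D(G)$ is the multiset of all induced subgraphs of $G$ (each up to isomorphism) having at most $(n+2)/2$ vertices. *)

(* Defs.v *)
From HB Require Import structures.
From mathcomp Require Import all_boot.

Set Implicit Arguments.
Unset Strict Implicit.
Unset Printing Implicit Defensive.

Record sgraph := SGraph {
  svertex :> finType;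
  adj : rel svertex;
  adj_sym : symmetric adj;
  adj_irrefl : irreflexive adj
}.

Section Induced.
Variables (G : sgraph) (A : {set G}).

Definition induced_adj : rel {x : G | x \in A} :=
  fun x y => adj (val x) (val y).

Lemma induced_adj_sym : symmetric induced_adj.
Proof. by move=> x y; rewrite /induced_adj adj_sym. Qed.

Lemma induced_adj_irrefl : irreflexive induced_adj.
Proof. by move=> x; rewrite /induced_adj adj_irrefl. Qed.

Definition induced : sgraph := SGraph induced_adj_sym induced_adj_irrefl.

End Induced.

Section PathGraph.
Variable r : nat.

Definition path_adj : rel 'I_r :=
  fun i j => (i.+1 == j :> nat) || (j.+1 == i :> nat).

Lemma path_adj_sym : symmetric path_adj.
Proof. by move=> i j; rewrite /path_adj orbC. Qed.

Lemma path_adj_irrefl : irreflexive path_adj.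
Proof. by move=> i; rewrite /path_adj orbb gtn_eqF. Qed.

Definition path_graph : sgraph := SGraph path_adj_sym path_adj_irrefl.

End PathGraph.

(* Boolean, so that isomorphic copies can be counted; see [isomorphicP]. *)
Definition isomorphic (G H : sgraph) : bool :=
  [exists f : {ffun G -> H}, [exists g : {ffun H -> G},
    [&& [forall x, g (f x) == x], [forall y, f (g y) == y]
      & [forall x, forall y, adj (f x) (f y) == adj x y]]]].

Lemma isomorphicP (G H : sgraph) :
  reflect (exists2 f : G -> H, bijective f & forall x y, adj (f x) (f y) = adj x y)
          (isomorphic G H).
Proof.
apply: (iffP existsP) => [[f /existsP[g /and3P[/forallP fK /forallP gK fe]]]|].
  exists f; first by exists g => x; apply/eqP.
  by move=> x y; apply/eqP; move/forallP: fe => /(_ x)/forallP/(_ y).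
move=> [f [g fK gK] fe]; exists (finfun f); apply/existsP; exists (finfun g).
apply/and3P; split; apply/forallP => x; rewrite ?ffunE ?fK ?gK //.
by apply/forallP => y; rewrite !ffunE fe.
Qed.

Definition degree (G : sgraph) (x : G) : nat := #|[set y | adj x y]|.

Definition connected_graph (G : sgraph) : Prop :=
  0 < #|G| /\ forall x y : G, connect (@adj G) x y.

(* [ucycle] also holds of sequences of length 0 and of edges [:: x; y], which
   are not cycles of a simple graph. *)
Definition acyclic_graph (G : sgraph) : Prop :=
  forall c : seq G, ucycle (@adj G) c -> size c <= 2.

Definition tree (G : sgraph) : Prop := connected_graph G /\ acyclic_graph G.

Definition nonleaf (G : sgraph) : {set G} := [set x | degree x != 1].

Definition caterpillar (G : sgraph) : Prop :=
  tree G /\ exists r, isomorphic (induced (nonleaf G)) (path_graph r).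

(* d_i is the entry of index i - 1. *)
Definition nonleaf_degrees (G : sgraph) : seq nat :=
  sort geq [seq degree x | x <- enum (nonleaf G)].

(* A multiset of isomorphism classes is given by its multiplicity function:
   [deck G F] is the number of vertex sets A of G with #|A| <= (#|G| + 2) / 2
   (a comparison of rationals) inducing a copy of F. *)
Definition deck (G F : sgraph) : nat :=
  #|[set A : {set G} | (2 * #|A| <= #|G| + 2) && isomorphic (induced A) F]|.

Definition reconstructible (G : sgraph) : Prop :=
  forall H : sgraph, deck H =1 deck G -> isomorphic H G.

(* Main.v *)
Require Import Defs.
From mathcomp Require Import all_boot all_order all_algebra zify ring lra.

Set Implicit Arguments.
Unset Strict Implicit.
Unset Printing Implicit Defensive.

Import Order.TTheory GRing.Theory Num.Theory.

(** A tuple of at most l = (n + 2) / 2 vertices spans a subgraph with at most l vertices,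
so the deck determines how many tuples have a prescribed pattern of equalities and
adjacencies.  A factor [degree v] counts one more vertex, adjacent to v.  Hence the sum of
P_0(deg v_0) ... P_k(deg v_k) over the non-backtracking walks v_0, ..., v_k is determined
as soon as k + 1 + deg P_0 + ... + deg P_k <= l.  If d bounds the degrees, a polynomial of
degree d - 1 separates leaves from the other vertices.

In a caterpillar the walks through non-leaf vertices are the windows of the spine, read in
both directions.  Let y_s = (degree of the s-th spine vertex) - 1.  Comparing walks of
lengths k and k + 1 isolates the windows at the two ends of the spine and yields
y_k + y'_k and y_j y_k + y'_j y'_k, where ' denotes the mirror position; these determine
the word y up to reversal.  The hypotheses on the degrees give n >= r + 3 d - 3, which
makes this work for all k < (r - 1) / 2.  At most two letters in the middle remain; they
follow from the power sums of the degrees, up to an exchange that the autocorrelations of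
y exclude unless y is otherwise a palindrome. *)

(** * Tuples with a prescribed pattern *)

Definition pattern (I : finType) := {ffun I * I -> bool * bool}.

Definition pat (X : sgraph) (I : finType) (x : {ffun I -> X}) : pattern I :=
  [ffun ij => (x ij.1 == x ij.2, adj (x ij.1) (x ij.2))].

Lemma pat_eq (X Y : sgraph) (I : finType) (x : {ffun I -> X}) (y : {ffun I -> Y}) :
  pat x = pat y ->
  forall i j, (x i == x j) = (y i == y j) /\ adj (x i) (x j) = adj (y i) (y j).
Proof. by move=> /ffunP E i j; move: (E (i, j)); rewrite !ffunE /= => -[-> ->]. Qed.

(** Sending [x i] to [y i] is well defined and injective because the equality bits agree, and it
    preserves adjacency because the other bits do. *)
Lemma pat_iso (X Y : sgraph) (I : finType) (x : {ffun I -> X}) (y : {ffun I -> Y}) :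
  pat x = pat y -> isomorphic (induced (x @: setT)) (induced (y @: setT)).
Proof.
move=> E.
have inv (Z : sgraph) (z : {ffun I -> Z}) (u : induced (z @: setT)) :
    {i : I | z i = val u}.
  have Pu : exists i, z i == val u.
    by case/imsetP: (valP u) => i _ ->; exists i.
  by exists (xchoose Pu); apply/eqP/(xchooseP Pu).
pose f (u : induced (x @: setT)) : induced (y @: setT) :=
  exist _ (y (sval (inv _ x u))) (imset_f y (in_setT _)).
pose g (u : induced (y @: setT)) : induced (x @: setT) :=
  exist _ (x (sval (inv _ y u))) (imset_f x (in_setT _)).
apply/isomorphicP; exists f; first exists g.
- move=> u; apply: val_inj => /=; case: (inv _ y _) => i /= Ei.
  case: (inv _ x u) Ei => j /= Ej Ei; rewrite -Ej; apply/eqP.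
  by rewrite (pat_eq E i j).1 Ei.
- move=> u; apply: val_inj => /=; case: (inv _ x _) => i /= Ei.
  case: (inv _ y u) Ei => j /= Ej Ei; rewrite -Ej; apply/eqP.
  by rewrite -(pat_eq E i j).1 Ei.
move=> u v; rewrite /= /induced_adj /=.
case: (inv _ x u) => i /= <-; case: (inv _ x v) => j /= <-.
by rewrite (pat_eq E i j).2.
Qed.

(** Tuples are transported along the isomorphism, so the number of tuples with image [A] depends
    only on the isomorphism class that [A] induces. *)
Lemma card_pat_image (X F : sgraph) (I : finType) (Q : pattern I) (A : {set X}) :
  isomorphic (induced A) F ->
  #|[set x : {ffun I -> X} | (pat x == Q) && (x @: setT == A)]| =
  #|[set x : {ffun I -> F} | (pat x == Q) && (x @: setT == setT)]|.
Proof.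
move=> /isomorphicP[f [g fK gK] fadj].
have gadj u v : adj (val (g u)) (val (g v)) = adj u v.
  by rewrite -{2}[u]gK -{2}[v]gK fadj.
have ginj u v : (val (g u) == val (g v)) = (u == v).
  by rewrite (inj_eq val_inj) (can_eq gK).
pose h (x : {ffun I -> F}) : {ffun I -> X} := [ffun i => val (g (x i))].
rewrite -(card_in_imset (f := h)); last first.
  move=> x y _ _ /ffunP E; apply/ffunP => i.
  by move/eqP: (E i); rewrite !ffunE ginj => /eqP.
congr #|pred_of_set _|; apply/setP => x; rewrite inE.
have pat_h y : pat (h y) = pat y.
  by apply/ffunP => -[i j]; rewrite !ffunE /= ginj gadj.
apply/andP/imsetP => [[/eqP xQ /eqP xA] | [y]].
  have Ax i : x i \in A by rewrite -xA imset_f.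
  pose y : {ffun I -> F} := [ffun i => f (exist _ (x i) (Ax i))].
  have xE : x = h y by apply/ffunP => i; rewrite !ffunE fK.
  exists y => //; rewrite inE -pat_h -xE xQ eqxx /=.
  apply/eqP/setP => u; rewrite inE; apply/imsetP.
  have: val (g u) \in A by apply: valP.
  move: (val (g u)) (ginj u) => v gv; rewrite -xA => /imsetP[i _ Ei].
  by exists i => //; apply/eqP; rewrite -gv Ei xE ffunE.
rewrite inE => /andP[/eqP yQ /eqP yT] ->; rewrite pat_h yQ; split=> //.
apply/eqP/setP => v; apply/imsetP/idP => [[i _ ->]|Av].
  by rewrite ffunE; apply: valP.
have: f (exist _ v Av) \in y @: setT by rewrite yT inE.
by case/imsetP => i _ Ei; exists i => //; rewrite ffunE -Ei fK.
Qed.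

(** Tuples are sorted by their image. An image has at most [#|I|] vertices, hence is counted by the
    deck, and by [pat_iso] it induces the same graph as the image of [y]. *)
Lemma card_pat_deck (X Y : sgraph) (I : finType) (y : {ffun I -> Y}) :
  2 * #|I| <= #|X| + 2 ->
  #|[set x : {ffun I -> X} | pat x == pat y]| =
  deck X (induced (y @: setT)) *
  #|[set x : {ffun I -> induced (y @: setT)} |
      (pat x == pat y) && (x @: setT == setT)]|.
Proof.
move=> leI.
rewrite -sum1dep_card (partition_big (fun x : {ffun I -> X} => x @: setT) predT) //=.
rewrite /deck -sum1dep_card big_distrl /=.
rewrite [RHS]big_mkcond /=; apply: eq_bigr => A _.
rewrite sum1dep_card; case: ifPn => [/andP[_ isoA]|].
  by rewrite mul1n -(card_pat_image _ isoA).
apply: contraNeq; rewrite -lt0n => /card_gt0P[x].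
rewrite inE => /andP[/eqP xy /eqP <-]; rewrite (pat_iso xy) andbT.
apply: leq_trans leI; rewrite leq_mul2l /=.
by rewrite -[#|I|]cardsT; apply: leq_imset_card.
Qed.

(** Single vertices always meet the size bound, so the multiplicity of the one-vertex graph is the
    order. *)
Lemma deck_card (G H : sgraph) : deck H =1 deck G -> #|H| = #|G|.
Proof.
suff deckK1 X : deck X (path_graph 1) = #|X| by move=> E; rewrite -!deckK1.
rewrite -[RHS]bin1 -(card_draws X 1) /deck; apply: eq_card => A; rewrite !inE.
apply/andP/cards1P => [[_ /isomorphicP[f [g fK gK] _]]|[v ->]].
  exists (val (g ord0)); apply/setP => u; rewrite inE.
  apply/idP/eqP => [Au|->]; last exact: valP.
  have E : f (exist _ u Au) = ord0 by exact: ord1.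
  by rewrite -E fK.
have Xgt0 : 0 < #|X| by apply/card_gt0P; exists v.
split; first by rewrite cards1; lia.
apply/isomorphicP; exists (fun=> ord0).
  exists (fun=> exist _ v (set11 v)) => [u|i]; last by apply/esym/ord1.
  by apply: val_inj => /=; have := valP u; rewrite inE => /eqP ->.
move=> u w; have := valP u; have := valP w; rewrite !inE => /eqP Ew /eqP Eu.
by rewrite [RHS]/= /induced_adj Eu Ew !adj_irrefl.
Qed.

(** [card_pat_deck] asks for a tuple realizing the pattern; it may be taken in either graph, and if
    neither has one, both counts are 0. *)
Lemma card_pat_eq (G H : sgraph) (I : finType) (Q : pattern I) :
  deck H =1 deck G -> 2 * #|I| <= #|G| + 2 ->
  #|[set x : {ffun I -> G} | pat x == Q]| = #|[set x : {ffun I -> H} | pat x == Q]|.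
Proof.
move=> E leI; have leIH : 2 * #|I| <= #|H| + 2 by rewrite (deck_card E).
have [/set0Pn[x]|/negbNE/eqP G0] := boolP ([set x : {ffun I -> G} | pat x == Q] != set0).
  by rewrite inE => /eqP <-; rewrite !card_pat_deck // E.
have [/set0Pn[x]|/negbNE/eqP ->] := boolP ([set x : {ffun I -> H} | pat x == Q] != set0).
  by rewrite inE => /eqP <-; rewrite !card_pat_deck // E.
by rewrite G0 !cards0.
Qed.

Local Open Scope ring_scope.

(** A pair [(j, c)] is a linear factor of a polynomial in the degree of [x j], with root [c]. The
    length of [fs] is the number of extra vertices that the weight costs. *)
Definition wt (X : sgraph) (I : finType) (fs : seq (I * int)) (x : {ffun I -> X}) : int :=
  \prod_(f <- fs) ((degree (x f.1))%:Z - f.2).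

(* The index [None] stands for a further vertex, adjacent to [x j]. *)
Definition ext_pred (I : finType) (Q : pred (pattern I)) (j : I) :
    pred (pattern (option I)) :=
  fun p => Q [ffun ij => p (Some ij.1, Some ij.2)] && (p (Some j, None)).2.

(** The degree of [x j] counts the ways to extend [x] by a neighbor of [x j]. The new entry may
    coincide with an old one, as tuples need not be injective. *)
Lemma sum_degree (X : sgraph) (I : finType) (Q : pred (pattern I)) (j : I)
    (fs : seq (I * int)) :
  \sum_(x : {ffun I -> X} | Q (pat x)) (degree (x j))%:Z * wt fs x =
  \sum_(x : {ffun option I -> X} | ext_pred Q j (pat x))
     wt [seq (Some f.1, f.2) | f <- fs] x.
Proof.
pose ex (xz : {ffun I -> X} * X) : {ffun option I -> X} :=
  [ffun o => if o is Some i then xz.1 i else xz.2].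
pose re (x : {ffun option I -> X}) : {ffun I -> X} * X :=
  ([ffun i => x (Some i)], x None).
have exK : cancel ex re.
  case=> x z; rewrite /re /ex !ffunE; congr (_, _) => /=.
  by apply/ffunP => i; rewrite !ffunE.
have reK : cancel re ex.
  by move=> x; apply/ffunP => -[i|]; rewrite !ffunE //= ffunE.
rewrite [RHS](reindex ex) /=; last by exists re => x _; [apply: exK | apply: reK].
rewrite (eq_bigl (fun xz : {ffun I -> X} * X => Q (pat xz.1) && adj (xz.1 j) xz.2)); last first.
  move=> [x z]; rewrite /ext_pred !ffunE /=; congr (Q _ && _).
  by apply/ffunP => -[i i']; rewrite !ffunE.
rewrite -(pair_big_dep (fun x : {ffun I -> X} => Q (pat x))
  (fun (x : {ffun I -> X}) z => adj (x j) z)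
  (fun x z => wt [seq (Some f.1, f.2) | f <- fs] (ex (x, z)))) /=.
apply: eq_bigr => x _.
rewrite (eq_bigr (fun=> wt fs x)); last first.
  by move=> z _; rewrite /wt big_map; apply: eq_bigr => f _; rewrite ffunE.
rewrite sumr_const /degree cardsE -mulr_natl; congr (_ * _).
by rewrite natz; congr (Posz _).
Qed.

Lemma sum_pat (G H : sgraph) (I : finType) (Q : pred (pattern I)) (fs : seq (I * int)) :
  deck H =1 deck G -> (2 * (#|I| + size fs) <= #|G| + 2)%N ->
  \sum_(x : {ffun I -> G} | Q (pat x)) wt fs x =
  \sum_(x : {ffun I -> H} | Q (pat x)) wt fs x.
Proof.
(* The index type and the predicate stay general: peeling off a factor turns it into a new index, so
   [#|I| + size fs] does not grow. *)
move=> E; have [k] := ubnP (size fs); elim: k => // k IHk in I Q fs *.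
case: fs => [_|[j c] fs] /=.
  rewrite addn0 => leI.
  have sumE (X : sgraph) : \sum_(x : {ffun I -> X} | Q (pat x)) wt [::] x =
      \sum_(q | Q q) #|[set x : {ffun I -> X} | pat x == q]|%:Z.
    rewrite (partition_big (fun x => pat x) Q) //=; apply: eq_bigr => q Qq.
    rewrite (eq_bigr (fun=> 1)); last by move=> x _; rewrite /wt big_nil.
    rewrite sumr_const natz cardsE; congr (Posz _); apply: eq_card => x.
    by rewrite !unfold_in /=; apply: andb_idl => /eqP ->.
  by rewrite !sumE; apply: eq_bigr => q _; rewrite (card_pat_eq q E).
rewrite ltnS => ltk leI.
have sumE (X : sgraph) : \sum_(x : {ffun I -> X} | Q (pat x)) wt ((j, c) :: fs) x =
    \sum_(x : {ffun option I -> X} | ext_pred Q j (pat x))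
      wt [seq (Some f.1, f.2) | f <- fs] x
    - c * \sum_(x : {ffun I -> X} | Q (pat x)) wt fs x.
  rewrite -sum_degree mulr_sumr -sumrB; apply: eq_bigr => x _.
  by rewrite /wt big_cons /= mulrBl.
rewrite !sumE; congr (_ - c * _); apply: IHk; rewrite ?size_map //.
  by rewrite card_option addSnnS.
by apply: leq_trans leI; rewrite leq_mul2l leq_add2l leqnSn.
Qed.

(** * Non-leaf vertices *)

Definition degrees_within (X : sgraph) (d : nat) : Prop :=
  forall v : X, (0 < degree v <= d)%N.

(* The product of [degree - c] for 2 <= c <= d vanishes at non-leaf vertices, and is the
   nonzero constant [leaf_const d] at leaves. *)
Definition leaf_factors (I : finType) (d : nat) (j : I) : seq (I * int) :=
  [seq (j, c%:Z) | c <- iota 2 d.-1].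

Definition leaf_const (d : nat) : int := \prod_(c <- iota 2 d.-1) (1 - c%:Z).

Lemma leaf_const_neq0 (d : nat) : leaf_const d != 0.
Proof.
rewrite /leaf_const prodf_seq_neq0; apply/allP => c; rewrite mem_iota /=; lia.
Qed.

Lemma wt_cat (X : sgraph) (I : finType) (fs gs : seq (I * int)) (x : {ffun I -> X}) :
  wt (fs ++ gs) x = wt fs x * wt gs x.
Proof. by rewrite /wt big_cat. Qed.

Lemma wt_leaf_factors (X : sgraph) (d : nat) (I : finType) (j : I) (x : {ffun I -> X}) :
  degrees_within X d ->
  wt (leaf_factors d j) x = leaf_const d * (degree (x j) == 1%N)%:R.
Proof.
move=> dX; rewrite /wt /leaf_factors big_map /=.
case: eqP => [->|/eqP nl]; first by rewrite mulr1.
rewrite mulr0; apply/eqP; rewrite prodf_seq_eq0; apply/hasP.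
exists (degree (x j)); last by rewrite /= subrr.
by have := dX (x j); rewrite mem_iota; lia.
Qed.

Lemma size_leaf_factors (d : nat) (I : finType) (j : I) :
  size (leaf_factors d j) = d.-1.
Proof. by rewrite size_map size_iota. Qed.

(** The indicator of a non-leaf is 1 minus that of a leaf, and the latter is a polynomial of degree
    [d.-1] in the degree. Each test therefore costs [d.-1] vertices. *)
Lemma sum_pat_nl (G H : sgraph) (d : nat) (I : finType) (Q : pred (pattern I))
    (js : seq I) (fs : seq (I * int)) :
  deck H =1 deck G -> degrees_within G d -> degrees_within H d ->
  (2 * (#|I| + size fs + size js * d.-1) <= #|G| + 2)%N ->
  \sum_(x : {ffun I -> G} | Q (pat x) && all (fun j => degree (x j) != 1) js) wt fs x =
  \sum_(x : {ffun I -> H} | Q (pat x) && all (fun j => degree (x j) != 1) js) wt fs x.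
Proof.
move=> E dG dH; elim: js fs => [|j js IHjs] fs leI.
  have sumE (X : sgraph) :
      \sum_(x : {ffun I -> X} | Q (pat x) && all (fun j => degree (x j) != 1) [::])
         wt fs x = \sum_(x : {ffun I -> X} | Q (pat x)) wt fs x.
    by apply: eq_bigl => x; rewrite andbT.
  by rewrite !sumE; apply: sum_pat => //; move: leI; rewrite mul0n addn0.
(* Multiplying by the constant keeps the leaf indicator integral. *)
apply: (mulfI (leaf_const_neq0 d)).
have sumE (X : sgraph) : degrees_within X d ->
    leaf_const d * \sum_(x : {ffun I -> X} |
      Q (pat x) && all (fun j => degree (x j) != 1) (j :: js)) wt fs x =
    leaf_const d * \sum_(x : {ffun I -> X} |
      Q (pat x) && all (fun j => degree (x j) != 1) js) wt fs x -
    \sum_(x : {ffun I -> X} |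
      Q (pat x) && all (fun j => degree (x j) != 1) js) wt (leaf_factors d j ++ fs) x.
  move=> dX; rewrite !mulr_sumr -sumrB.
  rewrite [LHS]big_mkcond [RHS]big_mkcond /=; apply: eq_bigr => x _.
  rewrite wt_cat (wt_leaf_factors _ _ dX).
  by case: (Q _); case: (all _ _); case: (degree _ == 1%N); rewrite //=; ring.
rewrite !sumE //; congr (leaf_const d * _ - _); apply: IHjs.
  by apply: leq_trans leI; rewrite leq_mul2l leq_add2l leq_mul2r leqnSn !orbT.
by move: leI; rewrite size_cat size_leaf_factors /= mulSn; lia.
Qed.

Lemma no_pat_nl (G H : sgraph) (d : nat) (I : finType) (Q : pred (pattern I))
    (js : seq I) :
  deck H =1 deck G -> degrees_within G d -> degrees_within H d ->
  (2 * (#|I| + size js * d.-1) <= #|G| + 2)%N ->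
  (forall x : {ffun I -> G},
     Q (pat x) -> all (fun j => degree (x j) != 1) js -> False) ->
  forall x : {ffun I -> H},
     Q (pat x) -> all (fun j => degree (x j) != 1) js -> False.
Proof.
move=> E dG dH leI GF x Qx jx.
have := @sum_pat_nl G H d I Q js [::] E dG dH.
rewrite addn0 => /(_ leI); rewrite big_pred0; last first.
  by move=> y; apply/negP => /andP[]; apply: GF.
rewrite (eq_bigr (fun=> 1)); last by move=> y _; rewrite /wt big_nil.
rewrite sumr_const natz => /esym[] /eqP; apply/negP; rewrite -lt0n.
by apply/card_gt0P; exists x; rewrite unfold_in Qx.
Qed.

(** The product of [degree - c] over 0 <= c <= d vanishes for degrees up to d and is positive
    beyond, so its sum, which is 0 in [G], excludes larger degrees in [H]. Once these are gone, the
    product over 1 <= c <= d detects isolated vertices. *)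
Lemma degrees_within_eq (G H : sgraph) (d : nat) :
  deck H =1 deck G -> degrees_within G d -> (2 * (d + 2) <= #|G| + 2)%N ->
  degrees_within H d.
Proof.
move=> E dG led.
have sumE (X : sgraph) (s : seq nat) :
    \sum_(x : {ffun unit -> X} | predT (pat x)) wt [seq (tt, c%:Z) | c <- s] x =
    \sum_(v : X) \prod_(c <- s) ((degree v)%:Z - c%:Z).
  rewrite (reindex (fun v : X => [ffun=> v])) /=; last first.
    exists (fun x : {ffun unit -> X} => x tt) => [v|x] _; first by rewrite ffunE.
    by apply/ffunP => -[]; rewrite ffunE.
  by apply: eq_bigr => v _; rewrite /wt big_map; apply: eq_bigr => c _; rewrite ffunE.
have sumGH s : (size s <= d.+1)%N ->
    \sum_(v : G) \prod_(c <- s) ((degree v)%:Z - c%:Z) =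
    \sum_(v : H) \prod_(c <- s) ((degree v)%:Z - c%:Z).
  move=> ls; rewrite -!sumE; apply: sum_pat => //.
  by rewrite size_map card_unit; lia.
have prod0 (X : sgraph) (v : X) s : degree v \in s ->
    \prod_(c <- s) ((degree v)%:Z - c%:Z) = 0.
  move=> vs; apply/eqP; rewrite prodf_seq_eq0; apply/hasP.
  by exists (degree v); rewrite //= subrr.
have leH (v : H) : (degree v <= d)%N.
  have := sumGH (iota 0 d.+1); rewrite size_iota leqnn => /(_ isT).
  rewrite big1; last by move=> u _; apply: prod0; rewrite mem_iota; have := dG u; lia.
  have ge0 (u : H) : 0 <= \prod_(c <- iota 0 d.+1) ((degree u)%:Z - c%:Z).
    have [le|lt] := leqP (degree u) d.
      by rewrite prod0 // mem_iota; lia.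
    by rewrite big_seq; apply: prodr_ge0 => c; rewrite mem_iota; lia.
  move/esym/eqP; rewrite psumr_eq0 // => /allP/(_ v (mem_index_enum v))/implyP/(_ isT).
  rewrite prodf_seq_eq0 => /hasP[c].
  by rewrite mem_iota; lia.
move=> v; rewrite leH andbT lt0n; apply/negP => /eqP v0.
have := sumGH (iota 1 d); rewrite size_iota leqnSn => /(_ isT).
rewrite big1; last by move=> u _; apply: prod0; rewrite mem_iota; have := dG u; lia.
have e0 (u : H) : \prod_(c <- iota 1 d) ((degree u)%:Z - c%:Z) =
    (\prod_(c <- iota 1 d) (0 - c%:Z)) * (degree u == 0%N)%:R.
  case: eqP => [->|/eqP nz]; first by rewrite mulr1.
  by rewrite mulr0 prod0 // mem_iota; have := leH u; lia.
rewrite (eq_bigr _ (fun u _ => e0 u)) -mulr_sumr => /esym/eqP; rewrite mulf_eq0.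
case/orP.
  by rewrite prodf_seq_eq0 => /hasP[c]; rewrite mem_iota; lia.
rewrite psumr_eq0 // => /allP/(_ v (mem_index_enum v))/=.
by rewrite v0.
Qed.

(** The product of the two leaf indicators is summed over adjacent pairs; this costs 2 + 2 (d - 1) =
    2 d vertices. *)
Lemma no_leaf_edge (G H : sgraph) (d : nat) :
  deck H =1 deck G -> degrees_within G d -> degrees_within H d ->
  (0 < d)%N -> (2 * (2 * d) <= #|G| + 2)%N ->
  (forall u v : G, adj u v -> degree u = 1%N -> degree v != 1%N) ->
  forall u v : H, adj u v -> degree u = 1%N -> degree v != 1%N.
Proof.
move=> E dG dH d0 led leafG u v uv u1; apply/eqP => v1.
pose Q (p : pattern bool) := (p (true, false)).2.
have /(_ _)/esym := @sum_pat G H _ Q (leaf_factors d true ++ leaf_factors d false) E.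
rewrite size_cat !size_leaf_factors card_bool => /(_ _)/wrap[]; first by lia.
have wtE (X : sgraph) (x : {ffun bool -> X}) : degrees_within X d ->
    wt (leaf_factors d true ++ leaf_factors d false) x =
    (leaf_const d ^+ 2) *
    ((degree (x true) == 1%N) && (degree (x false) == 1%N))%:R.
  by move=> dX; rewrite wt_cat !(wt_leaf_factors _ _ dX) -mulnb natrM; ring.
rewrite [RHS]big1; last first.
  move=> x; rewrite /Q ffunE /= => xx; rewrite wtE //.
  case: eqP => [x1|]; rewrite ?mulr0 //.
  by rewrite (negbTE (leafG _ _ xx x1)) mulr0.
rewrite (eq_bigr _ (fun x _ => wtE _ x dH)) -mulr_sumr => /eqP.
rewrite mulf_eq0 expf_eq0 (negbTE (leaf_const_neq0 d)) /=.
rewrite psumr_eq0 // => /allP/(_ _ (mem_index_enum [ffun b => if b then u else v]))/=.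
by rewrite !ffunE /= /Q ffunE /= !ffunE uv u1 v1.
Qed.

(** * Non-backtracking walks on a spine *)

(** Indexing by [nat] allows free index arithmetic on windows; values of [sp] from [r] on are
    unconstrained. *)
Record spine (X : sgraph) (r : nat) (sp : nat -> X) : Prop := Spine {
  spine_adj : forall i j, (i < r)%N -> (j < r)%N ->
    adj (sp i) (sp j) = (i.+1 == j) || (j.+1 == i);
  spine_inj : forall i j, (i < r)%N -> (j < r)%N -> sp i = sp j -> i = j;
  spine_nonleaf : forall i, (i < r)%N -> degree (sp i) != 1%N;
  spine_onto : forall v, degree v != 1%N -> exists2 i, (i < r)%N & v = sp i }.

Definition nb_walk (X : sgraph) (k : nat) (f : nat -> X) : Prop :=
  (forall i, (i < k)%N -> adj (f i) (f i.+1)) /\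
  (forall i, (i.+1 < k)%N -> f i != f i.+2).

Definition nb_pattern (k : nat) : pred (pattern 'I_k.+1) := fun p =>
  [forall i : 'I_k.+1, forall j : 'I_k.+1,
    ((i.+1 == j :> nat) ==> (p (i, j)).2) && ((i.+2 == j :> nat) ==> ~~ (p (i, j)).1)].

Definition restrict (X : sgraph) (k : nat) (f : nat -> X) : {ffun 'I_k.+1 -> X} :=
  [ffun i : 'I_k.+1 => f i].

Definition extend (X : sgraph) (k : nat) (x : {ffun 'I_k.+1 -> X}) : nat -> X :=
  fun i => x (inord i).

Lemma extendK (X : sgraph) (k : nat) (x : {ffun 'I_k.+1 -> X}) :
  restrict k (extend x) = x.
Proof. by apply/ffunP => i; rewrite ffunE /extend inord_val. Qed.

Lemma nb_patternP (X : sgraph) (k : nat) (f : nat -> X) :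
  reflect (nb_walk k f) (nb_pattern (pat (restrict k f))).
Proof.
apply: (iffP 'forall_forallP) => [Hf|[Ha Hn] i j].
  split=> i lti.
    have [lt0 lt1] : (i < k.+1 /\ i.+1 < k.+1)%N by lia.
    by have := Hf (Ordinal lt0) (Ordinal lt1); rewrite !ffunE /= eqxx => /andP[].
  have [lt0 lt1] : (i < k.+1 /\ i.+2 < k.+1)%N by lia.
  by have := Hf (Ordinal lt0) (Ordinal lt1); rewrite !ffunE /= eqxx => /andP[].
rewrite !ffunE /=; apply/andP; split; apply/implyP => /eqP ij.
  by rewrite -ij; apply: Ha; have := ltn_ord j; lia.
by rewrite -ij; apply: Hn; have := ltn_ord j; lia.
Qed.

Lemma two_neighbors (X : sgraph) (v a b : X) :
  adj v a -> adj v b -> a != b -> degree v != 1%N.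
Proof.
move=> va vb ab; apply/negP => /cards1P[c /setP E].
have := E a; have := E b; rewrite !inE va vb => /esym/eqP bc /esym/eqP ac.
by rewrite ac bc eqxx in ab.
Qed.

Lemma other_neighbor (X : sgraph) (v a : X) :
  (1 < degree a)%N -> exists2 b, adj a b & b != v.
Proof.
move=> lt1; have /card_gt0P[b] : (0 < #|[set u | adj a u] :\ v|)%N.
  have := cardsD1 v [set u | adj a u]; rewrite -/(degree a); lia.
by rewrite !inE => /andP[bv ab]; exists b.
Qed.

(** An interior vertex has two distinct neighbors on the walk. Hence only the two ends ever need a
    non-leaf test. *)
Lemma nb_walk_interior (X : sgraph) (k : nat) (f : nat -> X) (i : nat) :
  nb_walk k f -> (0 < i < k)%N -> degree (f i) != 1%N.
Proof.
move=> [fa fn]; case: i => // i /= lti.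
apply: (@two_neighbors X _ (f i) (f i.+2)); first by rewrite adj_sym fa //; lia.
  exact: fa.
by apply: fn; lia.
Qed.

Lemma nb_walk_sub (X : sgraph) (k l i : nat) (f : nat -> X) :
  nb_walk k f -> (i + l <= k)%N -> nb_walk l (fun j => f (i + j)%N).
Proof.
move=> [fa fn] le; split=> j lt; rewrite !addnS; first by apply: fa; lia.
by apply: fn; lia.
Qed.

Section SpineWalks.
Variables (X : sgraph) (r : nat) (sp : nat -> X).
Hypothesis spX : spine r sp.

(** On a path, a walk that never steps straight back cannot turn around, so the first step fixes its
    direction. *)
Lemma nb_walk_spine (k : nat) (f : nat -> X) :
  (0 < k)%N -> nb_walk k f -> (forall i, (i <= k)%N -> degree (f i) != 1%N) ->
  exists2 s, (s + k < r)%N &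
    (forall i, (i <= k)%N -> f i = sp (s + i)%N) \/
    (forall i, (i <= k)%N -> f i = sp (s + (k - i))%N).
Proof.
elim: k => // -[|k] IHk _ [fa fn] fnl.
  have [a lta fE0] := spine_onto spX (fnl 0%N isT).
  have [b ltb fE1] := spine_onto spX (fnl 1%N isT).
  have := fa 0%N isT; rewrite fE0 fE1 (spine_adj spX) // => /orP[]/eqP ab.
    exists a; first by lia.
    left=> -[|[|//]] _; first by rewrite fE0 addn0.
    by rewrite fE1 -ab addn1.
  exists b; first by lia.
  right=> -[|[|//]] _; first by rewrite fE0 -ab addn1.
  by rewrite fE1 subnn addn0.
have [|i le|s lts fE] := IHk isT.
- by split=> i lt; [apply: fa | apply: fn]; lia.
- by apply: fnl; lia.
have [b ltb fEb] := spine_onto spX (fnl k.+2 (leqnn _)).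
have := fa k.+1 (leqnn _); have := fn k (leqnn _); rewrite fEb.
case: fE => fE; rewrite !fE //.
  rewrite (spine_adj spX) //.
  move=> ne /orP[]/eqP E.
    exists s; first by lia.
    by left=> i; rewrite leq_eqVlt => /orP[/eqP ->|/fE //]; rewrite fEb; congr sp; lia.
  by move: ne; rewrite (_ : s + k = b)%N ?eqxx //; lia.
rewrite subnn addn0 (_ : k.+1 - k = 1)%N; last by lia.
rewrite (spine_adj spX) //; last by lia.
move=> ne /orP[]/eqP E; first by rewrite addn1 E eqxx in ne.
exists b; first by lia.
right=> i; rewrite leq_eqVlt => /orP[/eqP ->|lt]; first by rewrite fEb subnn addn0.
by rewrite fE //; congr sp; lia.
Qed.

Lemma nb_walk_up (s k : nat) : (s + k < r)%N -> nb_walk k (fun i => sp (s + i)%N).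
Proof.
move=> lt; split=> i lti; first by rewrite (spine_adj spX) ?addnS ?eqxx; lia.
by apply/eqP => /(spine_inj spX); lia.
Qed.

Lemma nb_walk_down (s k : nat) : (s + k < r)%N -> nb_walk k (fun i => sp (s + (k - i))%N).
Proof.
move=> lt; split=> i lti; first by rewrite (spine_adj spX); lia.
by apply/eqP => /(spine_inj spX); lia.
Qed.

(** A weight vanishing when an end is a leaf leaves only walks inside the spine, which are the
    windows read in the two directions. *)
Lemma sum_nb_walks (k : nat) (w : {ffun 'I_k.+1 -> X} -> int) :
  (0 < k)%N ->
  (forall x : {ffun 'I_k.+1 -> X}, degree (x ord0) = 1%N -> w x = 0) ->
  (forall x : {ffun 'I_k.+1 -> X}, degree (x ord_max) = 1%N -> w x = 0) ->
  \sum_(x : {ffun 'I_k.+1 -> X} | nb_pattern (pat x)) w x =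
  \sum_(s < r - k) (w (restrict k (fun i => sp (s + i)%N)) +
                    w (restrict k (fun i => sp (s + (k - i))%N))).
Proof.
move=> k0 w0 wk.
pose up (s : 'I_(r - k)) := restrict k (fun i => sp (s + i)%N).
pose dn (s : 'I_(r - k)) := restrict k (fun i => sp (s + (k - i))%N).
have ltr (s : 'I_(r - k)) : (s + k < r)%N by have := ltn_ord s; lia.
have inj_up : injective up.
  move=> s t /ffunP/(_ ord0); rewrite !ffunE !addn0 => /(spine_inj spX) E.
  by apply: val_inj; apply: E; have := ltr s; have := ltr t; lia.
have inj_dn : injective dn.
  move=> s t /ffunP/(_ ord_max); rewrite !ffunE /= !subnn !addn0 => /(spine_inj spX) E.
  by apply: val_inj; apply: E; have := ltr s; have := ltr t; lia.
(* An upward window at s equal to a downward one at t would give s = t + k and s + k = t, against k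
   > 0. *)
have disj : [disjoint [set up s | s : 'I_(r - k)] & [set dn s | s : 'I_(r - k)]].
  apply/pred0P => x /=; apply/negP => /andP[/imsetP[s _ ->] /imsetP[t _ /ffunP E]].
  have := ltr s; have := ltr t.
  have := E ord0; have := E ord_max; rewrite !ffunE /= subnn !addn0 subn0.
  move=> /(spine_inj spX) E1 /(spine_inj spX) E2; lia.
rewrite big_split /= -(big_imset w (in2W inj_up)) -(big_imset w (in2W inj_dn)) /=.
rewrite -bigU //= [RHS]big_mkcond [LHS]big_mkcond; apply: eq_bigr => x _.
have [xUD|xUD] := boolP (x \in _).
  suff -> : nb_pattern (pat x) by [].
  move: xUD; rewrite inE => /orP[]/imsetP[s _ ->]; apply/nb_patternP.
    exact: nb_walk_up.
  exact: nb_walk_down.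
case: ifP => // xnb; apply/eqP; apply: contraR xUD => wx.
have xw : nb_walk k (extend x) by apply/nb_patternP; rewrite extendK.
have xnl i : (i <= k)%N -> degree (extend x i) != 1%N.
  move=> le; have [i0|ik] := posnP i.
    apply: contra_neq wx => /= E; apply: w0; rewrite -E i0 /extend.
    by congr (degree (x _)); apply: val_inj; rewrite /= inordK.
  move: le; rewrite leq_eqVlt => /orP[/eqP E0|lt].
    apply: contra_neq wx => /= E; apply: wk; rewrite -E E0 /extend.
    by congr (degree (x _)); apply: val_inj; rewrite /= inordK.
  by apply: nb_walk_interior xw _; rewrite ik.
have [s lts fE] := nb_walk_spine k0 xw xnl.
have lts' : (s < r - k)%N by lia.
rewrite inE -(extendK x); apply/orP; case: fE => fE; [left|right];
  apply/imsetP; exists (Ordinal lts') => //; apply/ffunP => i;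
  by rewrite !ffunE /= fE // -ltnS.
Qed.

Lemma sum_vertices (w : {ffun 'I_1 -> X} -> int) :
  (forall x : {ffun 'I_1 -> X}, degree (x ord0) = 1%N -> w x = 0) ->
  \sum_(x : {ffun 'I_1 -> X} | nb_pattern (pat x)) w x =
  \sum_(s < r) w (restrict 0 (fun=> sp s)).
Proof.
move=> w0; pose f (s : 'I_r) := restrict 0 (fun=> sp s).
have inj_f : injective f.
  move=> s t /ffunP/(_ ord0); rewrite !ffunE => /(spine_inj spX) E.
  by apply: val_inj; apply: E.
rewrite -(big_imset w (in2W inj_f)) /= [RHS]big_mkcond [LHS]big_mkcond.
apply: eq_bigr => x _.
have -> : nb_pattern (pat x) by rewrite -[x]extendK; apply/nb_patternP.
case: ifPn => // xf; apply/eqP; apply: contraR xf => wx.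
have [|s lts xE] := spine_onto spX (v := x ord0).
  by apply: contra_neq wx => /w0.
apply/imsetP; exists (Ordinal lts) => //; apply/ffunP => i.
by rewrite ffunE /= -xE ord1.
Qed.

(** A walk with non-leaf ends runs monotonically along the spine and cannot close. If the common end
    is a leaf, removing it at both ends leaves a walk along the spine with distinct ends, and these
    are two neighbors of the leaf. *)
Lemma no_closed_nb_walk (k : nat) (f : nat -> X) :
  (0 < k)%N -> nb_walk k f -> f 0%N = f k -> False.
Proof.
move=> k0 fw E.
have [f0 | f0] := boolP (degree (f 0%N) == 1%N); last first.
  have [i le|s lts [fE|fE]] := nb_walk_spine k0 fw.
  - have [->//|i0] := posnP i.
    move: le; rewrite leq_eqVlt => /orP[/eqP ->|lt]; first by rewrite -E.
    by apply: nb_walk_interior fw _; rewrite i0.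
  - by move: E; rewrite !fE // => /(spine_inj spX); lia.
  - by move: E; rewrite !fE // => /(spine_inj spX); lia.
case: k => [//|[|[|k]]] in k0 fw E.
- by have := fw.1 0%N isT; rewrite E adj_irrefl.
- by have := fw.2 0%N isT; rewrite E eqxx.
have fw' := nb_walk_sub fw (leqnSn k.+2 : 1 + k.+1 <= k.+3)%N.
suff ne : f 1%N != f k.+2.
  move/eqP: f0; apply/eqP; apply: two_neighbors ne; first exact: fw.1.
  by rewrite E adj_sym; apply: fw.1.
have [//|i le|s lts fE] := nb_walk_spine _ fw'.
  by apply: nb_walk_interior fw _; lia.
apply/eqP => E'.
case: fE => fE; have := fE 0%N isT; have := fE k.+1 (leqnn _);
  rewrite addn0 add1n -E' => -> /(spine_inj spX); lia.
Qed.

Lemma spine_no_claw (v : X) (a : 'I_3 -> X) :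
  injective a -> (forall i, adj v (a i)) -> (forall i, degree (a i) != 1%N) -> False.
Proof.
move=> inj_a va anl.
have vnl : degree v != 1%N.
  apply: (two_neighbors (va ord0) (va ord_max)).
  by rewrite (inj_eq inj_a).
have [j ltj vE] := spine_onto spX vnl.
have [i0 lt0 E0] := spine_onto spX (anl (@Ordinal 3 0 isT)).
have [i1 lt1 E1] := spine_onto spX (anl (@Ordinal 3 1 isT)).
have [i2 lt2 E2] := spine_onto spX (anl (@Ordinal 3 2 isT)).
have := va (@Ordinal 3 0 isT); have := va (@Ordinal 3 1 isT).
have := va (@Ordinal 3 2 isT).
rewrite vE E0 E1 E2 !(spine_adj spX) // => h2 h1 h0.
have ne01 : i0 <> i1 by move=> e; rewrite e -E1 in E0; move/inj_a: E0.
have ne02 : i0 <> i2 by move=> e; rewrite e -E2 in E0; move/inj_a: E0.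
have ne12 : i1 <> i2 by move=> e; rewrite e -E2 in E1; move/inj_a: E1.
lia.
Qed.

End SpineWalks.

(** * Existence of a spine *)

Local Open Scope nat_scope.

Definition nb_count (X : sgraph) (k : nat) : nat :=
  #|[set x : {ffun 'I_k.+1 -> X} | nb_pattern (pat x) &&
     all (fun j => degree (x j) != 1) [:: ord0; ord_max]]|.

Definition spine_degree (X : sgraph) (v : X) : nat :=
  #|[set u | adj v u && (degree u != 1)]|.

Lemma card_dep_pair (T : finType) (A : pred T) (B : rel T) :
  #|[set ab : T * T | A ab.1 && B ab.1 ab.2]| = \sum_(a | A a) #|[set b | B a b]|.
Proof.
rewrite -sum1dep_card -(pair_big_dep A B (fun _ _ => 1)) /=.
by apply: eq_bigr => a _; rewrite sum1dep_card.
Qed.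

(** Both sides count the directed edges of the subgraph of non-leaves. *)
Lemma nb_count1 (X : sgraph) : nb_count X 1 = \sum_(v in nonleaf X) spine_degree v.
Proof.
rewrite (eq_bigl (fun v : X => degree v != 1)); last by move=> v; rewrite inE.
rewrite -(card_dep_pair (fun v : X => degree v != 1)
  (fun v u => adj v u && (degree u != 1))).
pose h (ab : X * X) := restrict 1 (fun i => if i == 0 then ab.1 else ab.2).
rewrite -(card_in_imset (f := h)); last first.
  move=> [a b] [c e] _ _ /ffunP E; have := E ord0; have := E ord_max.
  by rewrite !ffunE /= => -> ->.
rewrite /nb_count; apply: eq_card => x; rewrite inE.
apply/idP/imsetP => [|[[a b]]].
  rewrite -(extendK x) => /and3P[/nb_patternP[xa _]].
  rewrite !ffunE /= => x0 /andP[x1 _].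
  exists (extend x 0, extend x 1); first by rewrite inE /= x0 x1 xa.
  by apply/ffunP => -[[|[|//]] lti]; rewrite !ffunE.
rewrite inE /= => /and3P[a1 ab b1] ->; rewrite !ffunE /= a1 b1 !andbT.
by apply/nb_patternP; split=> -[|i].
Qed.

Section SpineExists.
Variables (X : sgraph) (r L : nat).
Hypothesis card_nl : #|nonleaf X| = r.
Hypothesis r_gt0 : 0 < r.
Hypothesis claw_free : forall (v : X) (a : 'I_3 -> X), injective a ->
  (forall i, adj v (a i)) -> (forall i, degree (a i) != 1) -> False.
Hypothesis no_closed : forall k (f : nat -> X),
  0 < k < L -> nb_walk k f -> f 0 = f k -> False.
Hypothesis count : forall k, 0 < k <= (r - L).+1 -> nb_count X k = 2 * (r - k).

Lemma spine_degree_le2 (v : X) : spine_degree v <= 2.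
Proof.
rewrite leqNgt; apply/negP => gt2.
have mem i := enum_valP (widen_ord gt2 i : 'I_#|_|).
apply: (@claw_free v (fun i => enum_val (widen_ord gt2 i : 'I_#|_|))) => [i j|i|i].
- by move=> /enum_val_inj/(congr1 val)/= E; apply: val_inj.
- by have := mem i; rewrite inE => /andP[].
- by have := mem i; rewrite inE => /andP[].
Qed.

Lemma sum_spine_degree : \sum_(v in nonleaf X) spine_degree v = 2 * (r - 1).
Proof. by rewrite -nb_count1 count. Qed.

(** The degrees in the subgraph of non-leaves sum to 2 (r - 1), less than 2 r. *)
Lemma spine_endpoint : exists2 u : X, degree u != 1 & spine_degree u <= 1.
Proof.
have [/existsP[u /andP[]]|none] :=
  boolP [exists u : X, (degree u != 1) && (spine_degree u <= 1)]; first by exists u.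
have : \sum_(v in nonleaf X) 2 <= \sum_(v in nonleaf X) spine_degree v.
  apply: leq_sum => v; rewrite inE => vnl; rewrite ltnNge.
  by apply: contraNN none => le; apply/existsP; exists v; rewrite vnl.
rewrite sum_spine_degree sum_nat_const card_nl; lia.
Qed.

Lemma spine_degree_ge (v : X) (s : seq X) :
  uniq s -> all (fun u => adj v u && (degree u != 1)) s -> size s <= spine_degree v.
Proof.
move=> us sv; rewrite -(card_uniqP us); apply: subset_leq_card.
by apply/subsetP => u /(allP sv); rewrite inE.
Qed.

(** In a longest path from [u] among the non-leaves, a non-leaf neighbor of the last vertex outside
    the path would extend it. *)
Lemma maximal_spine_path (u : X) : degree u != 1 -> exists m (f : nat -> X),
  [/\ f 0 = u, forall i, i <= m -> degree (f i) != 1,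
      forall i, i < m -> adj (f i) (f i.+1),
      forall i j, i <= m -> j <= m -> f i = f j -> i = j
    & forall v, degree v != 1 -> adj (f m) v -> exists2 j, j <= m & v = f j].
Proof.
move=> unl; pose e (a b : X) := adj a b && (degree b != 1).
pose P m := [exists p : m.-tuple X, path e u p && uniq (u :: p)].
have P0 : exists m, P m by exists 0; apply/existsP; exists [tuple].
have Pb m : P m -> m <= #|X|.
  case/existsP => p /andP[_ /card_uniqP E].
  by apply: leq_trans (max_card (mem (u :: p))); rewrite E /= size_tuple.
case: (ex_maxnP P0 Pb) => m /existsP[p /andP[pp up]] mmax.
exists m, (nth u (u :: p)); split=> //.
- move=> [//|i] lti /=.
  have := pathP u pp i; rewrite size_tuple => /(_ lti) /andP[] //.
- by move=> i lti; have := pathP u pp i; rewrite size_tuple => /(_ lti) /andP[].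
- move=> i j lei lej /eqP.
  by rewrite nth_uniq //= ?size_tuple ?ltnS // => /eqP.
move=> v vnl; have -> : nth u (u :: p) m = last u p by rewrite (last_nth u) size_tuple.
move=> lv; have [vp|vp] := boolP (v \in u :: p).
  exists (index v (u :: p)); last by rewrite nth_index.
  by move: vp; rewrite -index_mem /= size_tuple ltnS.
suff : m.+1 <= m by rewrite ltnn.
apply: mmax; apply/existsP; exists [tuple of rcons p v] => /=.
rewrite rcons_path pp /e lv vnl /=; move: up vp; rewrite /= rcons_uniq mem_rcons !inE !negb_or.
by move=> /andP[-> ->] /andP[vu ->]; rewrite eq_sym vu.
Qed.

Section SecondComponent.
Variables (C : {set X}).
Hypothesis C_nl : {subset C <= nonleaf X}.
Hypothesis C_closed : forall v w, v \in C -> adj v w -> degree w != 1 -> w \in C.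
Hypothesis C_deg : forall v, v \in C -> spine_degree v = 2.

Definition arcs : {set X * X} := [set ab | (ab.1 \in C) && (adj ab.1 ab.2 && (degree ab.2 != 1))].

(** In a 2-regular component an arc has exactly one continuation that does not turn back; the
    default only makes the map total. *)
Definition nb_step (ab : X * X) : X * X :=
  (ab.2, odflt ab.2 [pick c | [&& adj ab.2 c, degree c != 1 & c != ab.1]]).

Lemma card_arcs : #|arcs| = 2 * #|C|.
Proof.
rewrite /arcs (card_dep_pair (mem C) (fun a b => adj a b && (degree b != 1))).
by rewrite (eq_bigr (fun=> 2)) ?sum_nat_const ?(mulnC 2) // => v /C_deg.
Qed.

Lemma nb_stepP (ab : X * X) : ab \in arcs ->
  [/\ nb_step ab \in arcs & ab.1 != (nb_step ab).2].
Proof.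
case: ab => a b; rewrite !inE /= => /and3P[aC ab bnl].
have bC := C_closed aC ab bnl.
case: pickP => [c /and3P[bc cnl ca]|none] /=; first by rewrite bC bc cnl eq_sym.
have : 0 < #|[set u | adj b u && (degree u != 1)] :\ a|.
  by have := cardsD1 a [set u | adj b u && (degree u != 1)];
     have := C_deg bC; rewrite /spine_degree; lia.
case/card_gt0P => c; rewrite !inE => /and3P[ca bc cnl].
by have := none c; rewrite bc cnl ca.
Qed.

Definition arc_walk (ab : X * X) (i : nat) : X := (iter i nb_step ab).1.

Lemma arc_walkP (ab : X * X) (k : nat) : ab \in arcs ->
  nb_walk k (arc_walk ab) /\ forall i, arc_walk ab i \in C.
Proof.
move=> abC; have it i : iter i nb_step ab \in arcs.
  by elim: i => //= i /nb_stepP[].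
split; last by move=> i; have := it i; rewrite inE => /andP[].
split=> i _; rewrite /arc_walk /=; first by have := it i; rewrite inE => /and3P[].
by have [_] := nb_stepP (it i).
Qed.

(** The first [L] vertices of a walk generated by [nb_step] are distinct, since a repetition would
    close a walk of length below [L]. *)
Lemma leq_second_component : C != set0 -> L <= #|C|.
Proof.
case/set0Pn => v vC.
have : 0 < #|arcs| by rewrite card_arcs muln_gt0 /=; apply/card_gt0P; exists v.
case/card_gt0P => ab abC.
have inj_w : injective (fun i : 'I_L => arc_walk ab i).
  have lt_neq (i j : 'I_L) : i < j -> arc_walk ab i <> arc_walk ab j.
    move=> lt E; apply: (@no_closed (j - i) (fun l => arc_walk ab (i + l))).
    - by have := ltn_ord j; lia.
    - by have [wk _] := arc_walkP j abC; apply: nb_walk_sub wk _; lia.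
    - by rewrite addn0 E; congr arc_walk; lia.
  move=> i j E; apply: val_inj; case: (ltngtP i j) => // lt.
    by case: (lt_neq _ _ lt).
  by case: (lt_neq _ _ lt).
rewrite -[L]card_ord -(card_codom inj_w); apply: subset_leq_card.
by apply/subsetP => _ /codomP[i ->]; have [_] := arc_walkP 0 abC; apply.
Qed.

(** Every arc starts a walk of length [k], and the first two vertices of the walk recover the
    arc. *)
Lemma leq_nb_count (k : nat) : 0 < k -> 2 * #|C| <= nb_count X k.
Proof.
move=> k0; rewrite -card_arcs -(card_in_imset (f := fun ab => restrict k (arc_walk ab))).
  apply: subset_leq_card; apply/subsetP => _ /imsetP[ab abC ->].
  have [wk inC] := arc_walkP k abC.
  rewrite inE; apply/andP; split; first exact/nb_patternP.
  by rewrite /= !ffunE; have := C_nl (inC 0); have := C_nl (inC k); rewrite !inE => -> ->.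
move=> [a b] [a' b'] _ _ /ffunP E; have lt1 : 1 < k.+1 by [].
by have := E ord0; have := E (Ordinal lt1); rewrite !ffunE /arc_walk /= => -> ->.
Qed.

End SecondComponent.

(* A maximal path from an endpoint is a component of the subgraph of non-leaf vertices.
   By the number of edges, the other components form a 2-regular graph C, which has at
   least [L] vertices.  It supports 2 |C| walks of every length, too many for the length
   at which the path has none left. *)
Lemma spine_exists : exists sp : nat -> X, spine r sp.
Proof.
have [u unl u1] := spine_endpoint.
have [m [f [f0 fnl fa finj fmax]]] := maximal_spine_path unl.
(* A further non-leaf neighbor would give [u] two of them, or an inner vertex of the path three. *)
have nbr_lt i v : i < m -> degree v != 1 -> adj (f i) v ->
    v = f i.+1 \/ (0 < i /\ v = f i.-1).
  move=> lti vnl iv; have [->|vi1] := eqVneq v (f i.+1); [by left|right].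
  have fi1 := fa _ lti.
  case: i => [|i] in lti iv vi1 fi1 *.
    suff : 1 < spine_degree u by rewrite ltnNge u1.
    apply: (@spine_degree_ge u [:: f 1; v]) => /=; last by rewrite -f0 fi1 iv vnl fnl.
    by rewrite inE eq_sym vi1.
  split=> //; apply/eqP; apply: contraT => vi.
  suff : 2 < spine_degree (f i.+1) by rewrite ltnNge spine_degree_le2.
  apply: (@spine_degree_ge _ [:: f i; f i.+2; v]) => /=.
    rewrite !inE negb_or andbT [f i == v]eq_sym [f i.+2 == v]eq_sym vi vi1 !andbT.
    by apply/eqP => /finj; lia.
  by rewrite fi1 iv vnl adj_sym fa ?fnl //; lia.
have nbr i v : i <= m -> degree v != 1 -> adj (f i) v ->
    exists2 j, j <= m & v = f j /\ (i.+1 == j) || (j.+1 == i).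
  rewrite leq_eqVlt => /orP[/eqP ->|lti] vnl iv; last first.
    have [->|[i0 ->]] := nbr_lt _ _ lti vnl iv; first by exists i.+1; rewrite ?eqxx.
    by exists i.-1; [lia | split=> //; lia].
  (* At the last vertex, maximality places the neighbor at some [f j]; [nbr_lt] seen from [f j] then
     forces m = j + 1. *)
  have [j lej vE] := fmax _ vnl iv; exists j => //; split=> //; subst v.
  move: lej; rewrite leq_eqVlt => /orP[/eqP jm|ltj].
    by rewrite jm adj_irrefl in iv.
  rewrite adj_sym in iv.
  have [|[j0]] := nbr_lt _ _ ltj (fnl _ (leqnn m)) iv; move=> /finj; lia.
have f_adj i j : i <= m -> j <= m -> adj (f i) (f j) = (i.+1 == j) || (j.+1 == i).
  move=> lei lej; apply/idP/idP.
    by case/(nbr _ _ lei (fnl _ lej)) => j' lej' [/finj -> //].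
  case/orP => /eqP E; first by rewrite -E fa //; lia.
  by rewrite adj_sym -E fa //; lia.
pose P := [set f i | i : 'I_m.+1].
have PP v : reflect (exists2 i, i <= m & v = f i) (v \in P).
  apply: (iffP imsetP) => [[i _ ->]|[i lei ->]]; first by exists i; rewrite // -ltnS.
  by exists (Ordinal (lei : i < m.+1)).
have cardP : #|P| = m.+1.
  rewrite card_imset ?card_ord // => i j /finj E; apply: val_inj; apply: E.
    by rewrite -ltnS.
  by rewrite -ltnS.
have Pnl : P \subset nonleaf X.
  by apply/subsetP => v /PP[i lei ->]; rewrite inE fnl.
pose C := nonleaf X :\: P.
have cardC : #|C| = r - m.+1 by rewrite cardsD (setIidPr Pnl) card_nl cardP.
have ltmr : m < r by rewrite -card_nl -cardP subset_leq_card.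
have [C0|Cn0] := eqVneq C set0.
  have rE : r = m.+1 by move: cardC; rewrite C0 cards0; lia.
  exists f; split=> [i j|i j|i|v]; rewrite rE ?ltnS.
  - exact: f_adj.
  - exact: finj.
  - exact: fnl.
  move=> vnl; have /PP : v \in P.
    by apply: contraT => vP; have := in_set0 v; rewrite -C0 !inE vP vnl.
  by case=> i lei ->; exists i.
have C_nl : {subset C <= nonleaf X} by move=> v; rewrite !inE => /andP[].
have C_closed v w : v \in C -> adj v w -> degree w != 1 -> w \in C.
  rewrite !inE => /andP[vP vnl] vw ->; rewrite andbT.
  apply: contra vP => /PP[i lei wE]; rewrite wE adj_sym in vw.
  by have [j lej [-> _]] := nbr _ _ lei vnl vw; apply/PP; exists j.
have sumP : \sum_(v in P) spine_degree v <= 2 * m.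
  rewrite big_imset /=; last first.
    move=> i j _ _ /finj E; apply: val_inj; apply: E; by rewrite -ltnS.
  apply: (@leq_trans (\sum_(i < m.+1) ((i < m) + (0 < i)))).
    apply: leq_sum => i _; rewrite /spine_degree.
    have lei : i <= m by rewrite -ltnS.
    apply: (@leq_trans #|[set v in (if i < m then [:: f i.+1] else [::]) ++
                         (if 0 < i then [:: f i.-1] else [::])]|).
      apply: subset_leq_card; apply/subsetP => v; rewrite !inE => /andP[iv vnl].
      have [j lej [-> /orP[]/eqP E]] := nbr _ _ lei vnl iv.
        by rewrite mem_cat (_ : i < m) ?inE ?E ?eqxx //; lia.
      by rewrite mem_cat (_ : 0 < i) ?inE -?E ?eqxx ?orbT //; lia.
    rewrite cardsE; apply: leq_trans (card_size _) _; rewrite size_cat.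
    by case: ifP; case: ifP.
  rewrite big_split /= mulSn mul1n leq_add //.
    rewrite big_ord_recr /= ltnn addn0 (eq_bigr (fun=> 1)).
      by rewrite sum_nat_const card_ord muln1.
    by move=> i _; rewrite ltn_ord.
  rewrite big_ord_recl /= add0n (eq_bigr (fun=> 1)) //.
  by rewrite sum_nat_const card_ord muln1.
(* Of the total 2 (r - 1), the path takes at most 2 m, which leaves at least 2 (r - 1 - m) = 2
   |C|. *)
have sumC : 2 * #|C| <= \sum_(v in C) spine_degree v.
  have := sum_spine_degree; rewrite (big_setID P) /= (setIidPr Pnl) -/C cardC.
  by move: sumP; lia.
have C_deg v : v \in C -> spine_degree v = 2.
  move=> vC; apply/eqP; rewrite eqn_leq spine_degree_le2 /= leqNgt.
  apply/negP => lt; suff : \sum_(i in C) spine_degree i < \sum_(i in C) 2.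
    by rewrite sum_nat_const ltnNge mulnC sumC.
  rewrite (bigD1 v) //= [X in _ < X](bigD1 v) //= -addSn leq_add //.
  by apply: leq_sum => i _; apply: spine_degree_le2.
have leL := leq_second_component C_closed C_deg Cn0.
(* Length m + 1 would only give equality. Length m + 2 gives 2 |C| <= 2 (r - m - 2) = 2 (|C| - 1),
   and it lies in the range of [count] because L <= |C| = r - m - 1. *)
have := @leq_nb_count C C_nl C_closed C_deg m.+2 isT.
have Cgt0 : 0 < #|C| by rewrite card_gt0.
by rewrite count; lia.
Qed.

End SpineExists.

(** * Transfer of the spine *)

Local Open Scope ring_scope.

(** An end is kept away from leaves either by a test in [js], at the price of [d.-1] vertices, or by
    a factor [degree - 1] in the weight, at the price of one. *)
Lemma sum_spine (X : sgraph) (r k : nat) (sp : nat -> X) (js : seq 'I_k.+1)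
    (fs : seq ('I_k.+1 * int)) :
  spine r sp -> (0 < k)%N ->
  (ord0 \in js) || ((ord0, 1) \in fs) -> (ord_max \in js) || ((ord_max, 1) \in fs) ->
  \sum_(x : {ffun 'I_k.+1 -> X} | nb_pattern (pat x) &&
                                  all (fun j => degree (x j) != 1%N) js) wt fs x =
  \sum_(s < r - k) (\prod_(f <- fs) ((degree (sp (s + f.1)%N))%:Z - f.2) +
                    \prod_(f <- fs) ((degree (sp (s + (k - f.1))%N))%:Z - f.2)).
Proof.
move=> spX k0 m0 mk.
have w0 (j : 'I_k.+1) (x : {ffun 'I_k.+1 -> X}) : (j \in js) || ((j, 1) \in fs) ->
    degree (x j) = 1%N ->
    (if all (fun j => degree (x j) != 1%N) js then wt fs x else 0) = 0.
  case/orP => [jjs|jfs] xj1; first by rewrite ifN //; apply/allPn; exists j; rewrite ?xj1.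
  case: ifP => // _; apply/eqP; rewrite /wt prodf_seq_eq0; apply/hasP.
  by exists (j, 1); rewrite //= xj1 subrr.
rewrite big_mkcondr (sum_nb_walks spX k0); last 2 first.
- by move=> x; apply: w0.
- by move=> x; apply: w0.
apply: eq_bigr => s _; have lts : (s + k < r)%N by have := ltn_ord s; lia.
rewrite !ifT; last 2 first.
- by apply/allP => j _; rewrite ffunE (spine_nonleaf spX) //; lia.
- by apply/allP => j _; rewrite ffunE (spine_nonleaf spX) //; have := ltn_ord j; lia.
by congr (_ + _); apply: eq_bigr => f _; rewrite ffunE.
Qed.

Lemma sum_spine0 (X : sgraph) (r : nat) (sp : nat -> X) (fs : seq ('I_1 * int)) :
  spine r sp -> (ord0, 1) \in fs ->
  \sum_(x : {ffun 'I_1 -> X} | nb_pattern (pat x)) wt fs x =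
  \sum_(s < r) \prod_(f <- fs) ((degree (sp s))%:Z - f.2).
Proof.
move=> spX m0; rewrite (sum_vertices spX).
  by apply: eq_bigr => s _; apply: eq_bigr => f _; rewrite ffunE.
move=> x x1; apply/eqP; rewrite /wt prodf_seq_eq0; apply/hasP.
by exists (ord0, 1); rewrite //= x1 subrr.
Qed.

Lemma nb_count_sum (X : sgraph) (k : nat) :
  (nb_count X k)%:Z =
  \sum_(x : {ffun 'I_k.+1 -> X} | nb_pattern (pat x) &&
     all (fun j => degree (x j) != 1%N) [:: ord0; ord_max]) wt [::] x.
Proof.
rewrite (eq_bigr (fun=> 1)); last by move=> x _; rewrite /wt big_nil.
by rewrite sumr_const natz /nb_count cardsE.
Qed.

Lemma nb_count_spine (X : sgraph) (r k : nat) (sp : nat -> X) :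
  spine r sp -> (0 < k)%N -> nb_count X k = (2 * (r - k))%N.
Proof.
move=> spX k0; apply/eqP; rewrite -eqz_nat; apply/eqP.
rewrite nb_count_sum (sum_spine spX k0) ?inE ?eqxx ?orbT //.
rewrite (eq_bigr (fun=> 2)); last by move=> s _; rewrite !big_nil.
by rewrite sumr_const card_ord -mulr_natr; lia.
Qed.

Lemma card_nonleaf_eq (G H : sgraph) (d : nat) :
  deck H =1 deck G -> degrees_within G d -> degrees_within H d ->
  (2 * (1 + d.-1) <= #|G| + 2)%N -> #|nonleaf H| = #|nonleaf G|.
Proof.
move=> E dG dH le.
have sumE (X : sgraph) : (#|nonleaf X|)%:Z =
    \sum_(x : {ffun unit -> X} | predT (pat x) &&
       all (fun j => degree (x j) != 1%N) [:: tt]) wt [::] x.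
  rewrite (reindex (fun v : X => [ffun=> v])) /=; last first.
    exists (fun x : {ffun unit -> X} => x tt) => [v|x] _; first by rewrite ffunE.
    by apply/ffunP => -[]; rewrite ffunE.
  rewrite (eq_bigr (fun=> 1)); last by move=> x _; rewrite /wt big_nil.
  rewrite sumr_const natz; congr (Posz _); apply: eq_card => v.
  by rewrite !inE unfold_in /= ffunE andbT.
apply/eqP; rewrite -eqz_nat; apply/eqP.
rewrite !sumE; apply/esym; apply: (sum_pat_nl _ E dG dH).
by rewrite card_unit addn0 mul1n.
Qed.

Lemma card_nonleaf_spine (X : sgraph) (r : nat) (sp : nat -> X) :
  spine r sp -> #|nonleaf X| = r.
Proof.
move=> spX; have <- : [set sp i | i : 'I_r] = nonleaf X.
  apply/setP => v; rewrite inE; apply/imsetP/idP => [[i _ ->]|/(spine_onto spX)[i lti ->]].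
    exact: (spine_nonleaf spX).
  by exists (Ordinal lti).
rewrite card_imset ?card_ord // => i j /(spine_inj spX) E.
by apply: val_inj; apply: E.
Qed.

(* The three neighbors are certified as non-leaves by a second neighbor, which needs only
   seven vertices whatever [d] is. *)
Lemma no_claw (G H : sgraph) (r : nat) (sp : nat -> G) :
  deck H =1 deck G -> spine r sp -> (forall v : H, (0 < degree v)%N) ->
  (12 <= #|G|)%N ->
  forall (v : H) (a : 'I_3 -> H), injective a ->
  (forall i, adj v (a i)) -> (forall i, degree (a i) != 1%N) -> False.
Proof.
move=> E spG H0 n12 v a inj_a va anl.
(* [None] is the center, [Some (i, false)] its i-th neighbor, and [Some (i, true)] a further
   neighbor of that one. *)
pose I := option ('I_3 * bool)%type.
pose Q : pred (pattern I) := fun p =>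
  [forall i, [&& (p (None, Some (i, false))).2,
     (p (Some (i, false), Some (i, true))).2, ~~ (p (None, Some (i, true))).1
     & [forall j, (p (Some (i, false), Some (j, false))).1 ==> (i == j)]]].
have [b ab bv] : exists2 b : 'I_3 -> H, forall i, adj (a i) (b i) & forall i, v != b i.
  have nb i : exists b, adj (a i) b && (v != b).
    have [|b ab bv] := @other_neighbor H v (a i).
      by have := H0 (a i); have := anl i; lia.
    by exists b; rewrite ab eq_sym.
  by exists (fun i => xchoose (nb i)) => i; case/andP: (xchooseP (nb i)).
pose x : {ffun I -> H} :=
  [ffun o => if o is Some (i, t) then (if t then b i else a i) else v].
have Qx : Q (pat x).
  apply/forallP => i; rewrite !ffunE /= va ab bv /=.
  by apply/forallP => j; rewrite !ffunE /= (inj_eq inj_a); apply/implyP.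
have le7 : (2 * (#|{: I}| + size (Nil (I * int))) <= #|G| + 2)%N.
  by rewrite card_option card_prod card_ord card_bool addn0; lia.
have := sum_pat Q E le7; rewrite big_pred0; last first.
  move=> y; apply/negP => /forallP Qy.
  have {}Qy i : [/\ adj (y None) (y (Some (i, false))),
      adj (y (Some (i, false))) (y (Some (i, true))), y None != y (Some (i, true))
      & forall j, y (Some (i, false)) = y (Some (j, false)) -> i = j].
    have := Qy i; rewrite !ffunE /= => /and4P[-> -> -> /forallP inj]; split=> // j ij.
    by have := inj j; rewrite !ffunE /= ij eqxx => /eqP.
  apply: (@spine_no_claw G r sp spG (y None) (fun i => y (Some (i, false)))) => i.
  - by have [_ _ _] := Qy i.
  - by have [] := Qy i.
  - have [yi ij ne _] := Qy i.
    by apply: (two_neighbors _ ij ne); rewrite adj_sym.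
rewrite (eq_bigr (fun=> 1)); last by move=> y _; rewrite /wt big_nil.
rewrite sumr_const natz => /esym[] /eqP; apply/negP; rewrite -lt0n.
by apply/card_gt0P; exists x; rewrite unfold_in.
Qed.

Lemma no_closed_nb_walk_eq (G H : sgraph) (d r k : nat) (sp : nat -> G) (f : nat -> H) :
  deck H =1 deck G -> degrees_within G d -> degrees_within H d -> spine r sp ->
  (2 * k.+1 <= #|G| + 2)%N -> (0 < k)%N -> nb_walk k f -> f 0%N = f k -> False.
Proof.
move=> E dG dH spG lek k0 fw fE.
pose Q : pred (pattern 'I_k.+1) := fun p => nb_pattern p && (p (ord0, ord_max)).1.
apply: (@no_pat_nl G H d _ Q [::] E dG dH _ _ (restrict k f)) => //.
- by rewrite card_ord mul0n addn0.
- move=> x /andP[xnb]; rewrite ffunE /= => /eqP x0k _.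
  apply: (no_closed_nb_walk spG k0 (f := extend x)).
    by apply/nb_patternP; rewrite extendK.
  rewrite /extend; have -> : inord 0 = ord0 :> 'I_k.+1 by apply: val_inj; rewrite /= inordK.
  by rewrite x0k; congr (x _); apply: val_inj; rewrite /= inordK.
by apply/andP; split; [apply/nb_patternP | rewrite !ffunE /= fE].
Qed.

Lemma spine_transfer (G H : sgraph) (d r : nat) (sp : nat -> G) :
  deck H =1 deck G -> degrees_within G d -> degrees_within H d -> spine r sp ->
  (0 < r)%N -> (1 < d)%N -> (12 <= #|G|)%N -> (r + 3 * d <= #|G| + 3)%N ->
  (2 * (2 * d) <= #|G| + 2)%N ->
  exists sp' : nat -> H, spine r sp'.
Proof.
move=> E dG dH spG r0 d1 n12 ler led.
(* [L] is the largest order of a card. Walks of length k <= r - L + 1 with two end tests cost k + 1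
   + 2 (d - 1) vertices, which [ler] admits; if r < L, only k = 1 remains and [led] suffices. *)
apply: (@spine_exists H r ((#|G| + 2)./2)).
- rewrite (card_nonleaf_eq E dG dH) ?(card_nonleaf_spine spG) //; lia.
- by [].
- by apply: (no_claw E spG) => // v; case/andP: (dH v).
- move=> k f /andP[k0 ltk]; apply: (no_closed_nb_walk_eq E dG dH spG) => //; lia.
move=> k /andP[k0 lek]; rewrite -(nb_count_spine spG k0).
apply/eqP; rewrite -eqz_nat; apply/eqP.
rewrite !nb_count_sum; apply/esym; apply: (sum_pat_nl _ E dG dH).
rewrite card_ord addn0 [size _]/=; lia.
Qed.

(** * Words determined up to reversal *)

Local Open Scope ring_scope.

(** This sum and the next are over windows of k + 1 letters in both directions: [lin_sum] reads the
    last letter, [quad_sum] the letters at [j] and [k]. In [auto_sum] both directions give the same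
    product, which is taken once. *)
Definition lin_sum (r k : nat) (a : nat -> int) : int :=
  \sum_(s < r - k) (a (s + k)%N + a s).

Definition quad_sum (r j k : nat) (a : nat -> int) : int :=
  \sum_(s < r - k) (a (s + j)%N * a (s + k)%N + a (s + (k - j))%N * a s).

Definition auto_sum (r k : nat) (a : nat -> int) : int :=
  \sum_(s < r - k) a s * a (s + k)%N.

(** One summand runs over the letters from k on, the other over the first r - k; increasing k drops
    one letter from each. *)
Lemma lin_sumB (r k : nat) (a : nat -> int) : (k < r)%N ->
  lin_sum r k a - lin_sum r k.+1 a = a k + a (r - k.+1)%N.
Proof.
move=> lt; have [t ->] : exists t, r = (k + t.+1)%N by exists (r - k.+1)%N; lia.
rewrite /lin_sum (_ : k + t.+1 - k = t.+1)%N; last by lia.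
rewrite (_ : k + t.+1 - k.+1 = t)%N; last by lia.
rewrite !big_split /= big_ord_recl [X in _ + X - _]big_ord_recr /= add0n.
rewrite (eq_bigr (fun i : 'I_t => a (i + k.+1)%N)); last first.
  by move=> i _; rewrite /bump /=; congr a; lia.
ring.
Qed.

(** Raising [j] and [k] together keeps the lag k - j, so all products cancel but the first of the
    forward reading and the last of the backward one. *)
Lemma quad_sumB (r j k : nat) (a : nat -> int) : (j <= k)%N -> (k < r)%N ->
  quad_sum r j k a - quad_sum r j.+1 k.+1 a = a j * a k + a (r - j.+1)%N * a (r - k.+1)%N.
Proof.
move=> lejk lt; have [t ->] : exists t, r = (k + t.+1)%N by exists (r - k.+1)%N; lia.
rewrite /quad_sum (_ : k + t.+1 - k = t.+1)%N; last by lia.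
rewrite (_ : k + t.+1 - k.+1 = t)%N; last by lia.
rewrite subSS !big_split /= big_ord_recl [X in _ + X - _]big_ord_recr /= !add0n.
rewrite (eq_bigr (fun i : 'I_t => a (i + j.+1)%N * a (i + k.+1)%N)); last first.
  by move=> i _; rewrite /bump /=; congr (a _ * a _); lia.
rewrite (_ : t + (k - j) = k + t.+1 - j.+1)%N; last by lia.
ring.
Qed.

Lemma sum_two (n p : nat) (F : nat -> int) : (p.+1 < n)%N ->
  (forall s, (s < n)%N -> s != p -> s != p.+1 -> F s = 0) ->
  \sum_(s < n) F s = F p + F p.+1.
Proof.
move=> lt F0; have lt' : (p < n)%N by lia.
rewrite (bigD1 (Ordinal lt')) //= (bigD1 (Ordinal lt)) /=; last first.
  by rewrite -val_eqE /=; lia.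
rewrite big1 ?addr0 // => i /andP[ip ip1]; apply: F0; rewrite ?ltn_ord //.
Qed.

(* If the two middle letters are exchanged, the autocorrelations at lags 1, 2, ...
   compare ever more distant pairs of mirror letters, so the rest is a palindrome. *)
Lemma swapped_center (h : nat) (a b : nat -> int) :
  (forall s, (s < h)%N -> b s = a s) ->
  (forall s, (h.+1 < s < h.*2.+2)%N -> b s = a s) ->
  (forall k, (0 < k <= h)%N -> auto_sum h.*2.+2 k a = auto_sum h.*2.+2 k b) ->
  b h = a h.+1 -> b h.+1 = a h -> a h != a h.+1 ->
  forall s, (s < h)%N -> a s = a (h.*2.+1 - s)%N.
Proof.
move=> low high auto bh bh1 neq.
pose z s := a s + b s; pose e s := a s - b s.
have e0 s : (s < h.*2.+2)%N -> s != h -> s != h.+1 -> e s = 0.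
  move=> lts nh nh1; rewrite /e; have [lt|ge] := ltnP s h; first by rewrite low ?subrr.
  by rewrite high ?subrr //; lia.
have eh : e h = a h - a h.+1 by rewrite /e bh.
have eh1 : e h.+1 = - (a h - a h.+1) by rewrite /e bh1; ring.
have step k : (0 < k <= h)%N ->
    z (h - k)%N - z (h.+1 + k)%N = z (h.+1 - k)%N - z (h + k)%N.
  move=> lek; have := auto k lek; rewrite /auto_sum => /eqP.
  rewrite -subr_eq0 -sumrB => /eqP S0.
  (* Polarization: twice the difference of the products of [a] and of [b] is e z' + z e', where [e]
     is supported on the two middle positions. *)
  have : \sum_(s < h.*2.+2 - k) (e s * z (s + k)%N + z s * e (s + k)%N) = 0.
    apply: etrans (etrans (congr1 ( *%R 2) S0) (mulr0 2)); rewrite mulr_sumr.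
    by apply: eq_bigr => s _; rewrite /e /z; ring.
  rewrite big_split /= (@sum_two _ h (fun s => e s * z (s + k)%N)); last 2 first.
  - lia.
  - by move=> s lts nh nh1; rewrite e0 ?mul0r //; lia.
  rewrite (@sum_two _ (h - k) (fun s => z s * e (s + k)%N)); last 2 first.
  - lia.
  - by move=> s lts nh nh1; rewrite e0 ?mulr0 //; lia.
  rewrite (_ : h - k + k = h)%N; last by lia.
  rewrite (_ : (h - k).+1 + k = h.+1)%N; last by lia.
  rewrite (_ : (h - k).+1 = h.+1 - k)%N; last by lia.
  rewrite eh eh1 => S1; apply/eqP; rewrite -subr_eq0; apply/eqP.
  have : (a h - a h.+1) *
    (z (h - k)%N - z (h.+1 + k)%N - (z (h.+1 - k)%N - z (h + k)%N)) = 0.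
    by rewrite -S1; ring.
  by move/eqP; rewrite mulf_eq0 subr_eq0 (negbTE neq) => /eqP.
(* The relations of [step] chain outward from the center, where the exchange makes [z] symmetric. *)
have pal k : (k <= h)%N -> z (h - k)%N - z (h.+1 + k)%N = 0.
  elim: k => [_|k IHk ltk]; first by rewrite subn0 addn0 /z bh bh1; ring.
  rewrite step // -(IHk (ltnW ltk)) subSS; congr (_ - z _); lia.
move=> s lts; have := pal (h - s)%N (leq_subr _ _).
rewrite (_ : h - (h - s) = s)%N; last by lia.
rewrite (_ : h.+1 + (h - s) = h.*2.+1 - s)%N; last by lia.
rewrite /z low // high; last by lia.
lra.
Qed.

(** One middle letter is unknown for r = 2 h + 1 and follows from the sum. For r = 2 h + 2 there are
    two, known up to order from the sum and the sum of squares; if they are exchanged,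
    [swapped_center] makes the rest a palindrome, so that [b] is the reversal of [a]. *)
Lemma word_center (r h : nat) (a b : nat -> int) :
  h = (r.-1)./2 -> (0 < r)%N ->
  (forall s, (s < h)%N -> b s = a s /\ b (r - s.+1)%N = a (r - s.+1)%N) ->
  \sum_(s < r) a s = \sum_(s < r) b s ->
  \sum_(s < r) a s ^+ 2 = \sum_(s < r) b s ^+ 2 ->
  (forall k, (0 < k <= h)%N -> auto_sum r k a = auto_sum r k b) ->
  (forall s, (s < r)%N -> b s = a s) \/ (forall s, (s < r)%N -> b s = a (r - s.+1)%N).
Proof.
move=> hE r0 ends sum1 sum2 auto.
have high s : (r - h <= s < r)%N -> b s = a s.
  move=> /andP[ge lt]; have [|_] := ends (r - s.+1)%N; first by lia.
  by rewrite (_ : r - (r - s.+1).+1 = s)%N //; lia.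
have [rE|rE] : r = h.*2.+1 \/ r = h.*2.+2 by lia.
  left=> s lts; have [->|sh] := eqVneq s h; last first.
    have [lt|ge] := ltnP s h; first by have [] := ends s lt.
    by apply: high; lia.
  have lth : (h < r)%N by lia.
  move: sum1; rewrite (bigD1 (Ordinal lth)) //= [RHS](bigD1 (Ordinal lth)) //=.
  rewrite [X in _ + X = _](eq_bigr (fun i : 'I_r => b i)); first by move/addIr.
  move=> i; rewrite -val_eqE /= => ih; have lti := ltn_ord i.
  by have [lt|ge] := ltnP i h; [have [] := ends i lt | rewrite high //; lia].
subst r.
have low s : (s < h)%N -> b s = a s by move=> lt; have [] := ends s lt.
have high' s : (h.+1 < s < h.*2.+2)%N -> b s = a s by move=> lt; apply: high; lia.
have sum2E (F : int -> int) : \sum_(s < h.*2.+2) F (a s) = \sum_(s < h.*2.+2) F (b s) ->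
    F (a h) + F (a h.+1) = F (b h) + F (b h.+1).
  move/eqP; rewrite -subr_eq0 -sumrB.
  rewrite (@sum_two _ h (fun s => F (a s) - F (b s))); last 2 first.
  - lia.
  - move=> s lts nh nh1; have [lt|ge] := ltnP s h; first by rewrite low ?subrr.
    by rewrite high' ?subrr //; lia.
  by move/eqP => S; apply/eqP; rewrite -subr_eq0 -S; apply/eqP; ring.
have S1 := sum2E id sum1; have S2 := sum2E (fun x => x ^+ 2) sum2.
(* The two pairs have equal sum and equal sum of squares, so [b h] is a root of the quadratic with
   roots [a h] and [a h.+1]. *)
have : (b h - a h) * (b h - a h.+1) = 0.
  have E : b h.+1 = a h + a h.+1 - b h by rewrite S1 /=; ring.
  move: S2; rewrite /= E => S2.
  apply: (@mulfI _ (2 : int)) => //; rewrite mulr0.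
  apply: etrans (_ : b h ^+ 2 + (a h + a h.+1 - b h) ^+ 2 -
    (a h ^+ 2 + a h.+1 ^+ 2) = 0); first ring.
  by rewrite S2 subrr.
move/eqP; rewrite mulf_eq0 !subr_eq0.
have eqs : b h = a h -> forall s, (s < h.*2.+2)%N -> b s = a s.
  move=> bh s lts; have bh1 : b h.+1 = a h.+1 by move: S1; rewrite bh /= => /addrI.
  have [->//|nh] := eqVneq s h; have [->//|nh1] := eqVneq s h.+1.
  by have [lt|ge] := ltnP s h; [exact: low | apply: high'; lia].
case: (eqVneq (b h) (a h)) => [/eqs|ne /eqP bh]; first by left.
right=> s lts.
have bh1 : b h.+1 = a h by move: S1; rewrite bh /= [a h + _]addrC => /addrI.
have neq : a h != a h.+1 by rewrite -bh eq_sym.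
have pal := swapped_center low high' auto bh bh1 neq.
have [->|nh] := eqVneq s h; first by rewrite bh; congr a; lia.
have [->|nh1] := eqVneq s h.+1; first by rewrite bh1; congr a; lia.
have [lt|ge] := ltnP s h; first by rewrite low // pal //; congr a; lia.
rewrite high'; last by lia.
by rewrite [RHS]pal; [congr a; lia | lia].
Qed.

Lemma sum_rev (r : nat) (F : nat -> int) :
  \sum_(s < r) F (r - s.+1)%N = \sum_(s < r) F s.
Proof. by rewrite [RHS](reindex_inj rev_ord_inj). Qed.

Lemma auto_sum_rev (r k : nat) (b : nat -> int) :
  auto_sum r k (fun s => b (r - s.+1)%N) = auto_sum r k b.
Proof.
rewrite /auto_sum [RHS](reindex_inj rev_ord_inj); apply: eq_bigr => s _ /=.
have lts := ltn_ord s; rewrite mulrC; congr (b _ * b _); lia.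
Qed.

(* Put d_e for the difference of the e-th letters from both ends.  The linear sums give
   the sums of these two letters and the quadratic ones the products d_e * d_f, hence
   all the d_e up to a common sign. *)
Lemma word_determined (r h : nat) (a b : nat -> int) :
  h = (r.-1)./2 -> (0 < r)%N ->
  \sum_(s < r) a s = \sum_(s < r) b s ->
  \sum_(s < r) a s ^+ 2 = \sum_(s < r) b s ^+ 2 ->
  (forall k, (0 < k <= h)%N -> lin_sum r k a = lin_sum r k b) ->
  (forall j k, (0 < k <= h)%N -> (j <= k)%N -> quad_sum r j k a = quad_sum r j k b) ->
  (forall k, (0 < k <= h)%N -> auto_sum r k a = auto_sum r k b) ->
  (forall s, (s < r)%N -> b s = a s) \/ (forall s, (s < r)%N -> b s = a (r - s.+1)%N).
Proof.
move=> hE r0 sum1 sum2 lin0 quad0 auto.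
(* At k = 0 the linear sum, and likewise the quadratic one below, is twice a power sum, so the
   hypotheses on power sums supply this case. *)
have lin k : (k <= h)%N -> lin_sum r k a = lin_sum r k b.
  case: k => [_|k lek]; last exact: lin0.
  have dbl c : lin_sum r 0 c = 2 * \sum_(s < r) c s.
    rewrite /lin_sum subn0 mulr_sumr; apply: eq_bigr => s _; rewrite addn0; ring.
  by rewrite !dbl sum1.
have quad j k : (j <= k <= h)%N -> quad_sum r j k a = quad_sum r j k b.
  case: k => [|k /andP[lej lek]]; last exact: quad0.
  rewrite leqn0 andbT => /eqP ->.
  have dbl c : quad_sum r 0 0 c = 2 * \sum_(s < r) c s ^+ 2.
    rewrite /quad_sum subn0 mulr_sumr; apply: eq_bigr => s _.
    by rewrite subnn addn0; ring.
  by rewrite !dbl sum2.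
pose d (c : nat -> int) s := c s - c (r - s.+1)%N.
have addE s : (s < h)%N -> a s + a (r - s.+1)%N = b s + b (r - s.+1)%N.
  by move=> lts; rewrite -!lin_sumB ?lin //; lia.
have mulE e f : (e <= f < h)%N ->
    a e * a f + a (r - e.+1)%N * a (r - f.+1)%N =
    b e * b f + b (r - e.+1)%N * b (r - f.+1)%N.
  by move=> lt; rewrite -!quad_sumB ?quad //; lia.
have dE' e f : (e <= f < h)%N -> d a e * d a f = d b e * d b f.
  move=> lt; have M := mulE e f lt.
  have Ae : a e + a (r - e.+1)%N = b e + b (r - e.+1)%N by apply: addE; lia.
  have Af : a f + a (r - f.+1)%N = b f + b (r - f.+1)%N by apply: addE; lia.
  rewrite /d; transitivity (2 * (a e * a f + a (r - e.+1)%N * a (r - f.+1)%N) -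
    (a e + a (r - e.+1)%N) * (a f + a (r - f.+1)%N)); first ring.
  by rewrite M Ae Af; ring.
have dE e f : (e < h)%N -> (f < h)%N -> d a e * d a f = d b e * d b f.
  move=> lte ltf; case: (leqP e f) => le; first by apply: dE'; rewrite le.
  by rewrite mulrC [RHS]mulrC; apply: dE'; lia.
(* If all differences agree, so do the outer letters. Otherwise the squares give the opposite sign
   at some [e] where the difference is nonzero; the products spread this sign to every position, and
   the reversal of [b] has the outer letters of [a]. *)
have [/existsP[e /= ne]|eqd] := boolP [exists e : 'I_h, d b e != d a e]; last first.
  apply: word_center auto => // s lts.
  have := addE s lts; move: eqd; rewrite negb_exists => /forallP/(_ (Ordinal lts)) /=.
  rewrite negbK => /eqP; rewrite /d => ? ?; split; lra.
have lte := ltn_ord e.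
have opp f : (f < h)%N -> d b f = - d a f.
  have dbe : d b e = - d a e.
    apply/eqP; rewrite -subr_eq0 opprK; have /eqP := dE e e lte lte.
    rewrite -subr_eq0 -!expr2 subr_sqr mulf_eq0 subr_eq0 eq_sym (negbTE ne) /=.
    by rewrite addrC.
  have dae : d a e != 0 by apply: contraNneq ne => E; rewrite dbe E oppr0.
  move=> ltf; apply: (mulfI dae); rewrite mulrN (dE e f lte ltf) dbe; ring.
have [||||rev|rev] := @word_center r h a (fun s => b (r - s.+1)%N) hE r0.
- move=> s lts; have := addE s lts; have := opp s lts; rewrite /d.
  rewrite (_ : r - (r - s.+1).+1 = s)%N; last by lia.
  by move=> ? ?; split; lra.
- by rewrite sum_rev.
- by rewrite (sum_rev r (fun s => b s ^+ 2)).
- by move=> k lek; rewrite auto_sum_rev auto.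
- right=> s lts; rewrite -rev; last by lia.
  by congr b; lia.
left=> s lts; have := rev (r - s.+1)%N; rewrite (_ : r - (r - s.+1).+1 = s)%N; last by lia.
by apply; lia.
Qed.

(** * Caterpillars with equal words *)

Local Open Scope nat_scope.

Section Leaves.
Variables (X : sgraph) (r : nat) (sp : nat -> X).
Hypothesis spX : spine r sp.
Hypothesis leaf_edge : forall u v : X, adj u v -> degree u = 1 -> degree v != 1.

Definition leaves (i : nat) : seq X :=
  [seq v <- enum X | (degree v == 1) && adj (sp i) v].

(** A leaf is placed at its neighbor on the spine, so adjacency becomes a function of leaf status
    and position. *)
Definition spine_pos (v : X) : nat :=
  find (fun i => if degree v == 1 then adj (sp i) v else v == sp i) (iota 0 r).

Lemma leaf_neighbor (v a b : X) : degree v = 1 -> adj v a -> adj v b -> a = b.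
Proof.
move=> v1 va vb; apply/eqP; apply: contraT => ab.
by have := two_neighbors va vb ab; rewrite v1.
Qed.

Lemma spine_posP (v : X) :
  spine_pos v < r /\ (if degree v == 1 then adj (sp (spine_pos v)) v
                      else v == sp (spine_pos v)).
Proof.
set P := fun i => if degree v == 1 then adj (sp i) v else v == sp i.
have hasP : has P (iota 0 r).
  apply/hasP; have [v1|vnl] := eqVneq (degree v) 1; last first.
    have [i lti vE] := spine_onto spX vnl; exists i; first by rewrite mem_iota.
    by rewrite /P (negbTE vnl); apply/eqP.
  have /card_gt0P[u] : 0 < #|[set u | adj v u]| by rewrite -/(degree v) v1.
  rewrite inE => vu; have [i lti uE] := spine_onto spX (leaf_edge vu v1).
  by exists i; rewrite ?mem_iota // /P v1 eqxx -uE adj_sym.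
have lt : spine_pos v < r by have := hasP; rewrite has_find size_iota.
by split=> //; have := nth_find 0 hasP; rewrite nth_iota ?add0n.
Qed.

Lemma spine_pos_lt (v : X) : spine_pos v < r.
Proof. by have [] := spine_posP v. Qed.

Lemma spine_pos_nonleaf (v : X) : degree v != 1 -> v = sp (spine_pos v).
Proof. by move=> /negbTE v1; have [_] := spine_posP v; rewrite v1 => /eqP. Qed.

Lemma spine_pos_leaf (v : X) : degree v = 1 -> adj (sp (spine_pos v)) v.
Proof. by move=> v1; have [_] := spine_posP v; rewrite v1. Qed.

Lemma spine_posE (i : nat) : i < r -> spine_pos (sp i) = i.
Proof.
move=> lti; apply: (spine_inj spX) => //; first exact: spine_pos_lt.
by rewrite -spine_pos_nonleaf // (spine_nonleaf spX).
Qed.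

Lemma leaf_adjE (v : X) (i : nat) : degree v = 1 -> i < r ->
  adj (sp i) v = (i == spine_pos v).
Proof.
move=> v1 lti; apply/idP/eqP => [iv|->]; last exact: spine_pos_leaf.
apply: (spine_inj spX) => //; first exact: spine_pos_lt.
by apply: (leaf_neighbor v1); rewrite adj_sym // spine_pos_leaf.
Qed.

Lemma adj_spine_pos (v w : X) :
  adj v w = if degree v == 1 then (degree w != 1) && (spine_pos v == spine_pos w)
            else if degree w == 1 then spine_pos v == spine_pos w
            else ((spine_pos v).+1 == spine_pos w) || ((spine_pos w).+1 == spine_pos v).
Proof.
case: eqP => [v1|/eqP vnl]; case: eqP => [w1|/eqP wnl] /=.
- by apply/negP => /leaf_edge/(_ v1); rewrite w1.
- by rewrite {1}(spine_pos_nonleaf wnl) adj_sym leaf_adjE ?spine_pos_lt //.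
- by rewrite {1}(spine_pos_nonleaf vnl) leaf_adjE ?spine_pos_lt.
by rewrite {1}(spine_pos_nonleaf vnl) {1}(spine_pos_nonleaf wnl) (spine_adj spX) ?spine_pos_lt.
Qed.

Lemma mem_leaves (v : X) (i : nat) : i < r ->
  (v \in leaves i) = (degree v == 1) && (spine_pos v == i).
Proof.
move=> lti; rewrite mem_filter mem_enum andbT.
by case: eqP => //= v1; rewrite leaf_adjE // eq_sym.
Qed.

Lemma leaves_uniq (i : nat) : uniq (leaves i).
Proof. exact/filter_uniq/enum_uniq. Qed.

(** The second term depends only on [i] and [r]. Equal degrees on two spines of length [r] thus give
    equal numbers of leaves. *)
Lemma size_leaves (i : nat) : i < r ->
  size (leaves i) + #|[set j : 'I_r | (i.+1 == j) || (j.+1 == i)]| = degree (sp i).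
Proof.
move=> lti; rewrite /degree -(cardsID (nonleaf X) [set y | adj (sp i) y]) addnC.
congr (_ + _).
  rewrite -(card_imset (f := fun j : 'I_r => sp j)); last first.
    by move=> j k /(spine_inj spX) E; apply: val_inj; apply: E.
  apply: eq_card => v; rewrite !inE; apply/imsetP/andP => [[j]|[iv vnl]].
    by rewrite inE => ij ->; rewrite (spine_adj spX) ?(spine_nonleaf spX) ?ij.
  have [j ltj vE] := spine_onto spX vnl; exists (Ordinal ltj) => //.
  by rewrite inE /= -(spine_adj spX) -?vE.
rewrite -(card_uniqP (leaves_uniq i)); apply: eq_card => v.
by rewrite mem_filter mem_enum andbT !inE negbK.
Qed.

(** Each spine vertex contributes its degree minus its spine neighbors as leaves, and the spine has
    r - 1 edges. *)
Lemma leq_card_spine : 2 <= r ->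
  r + \sum_(i < r) degree (sp i) <= #|X| + 2 * (r - 1).
Proof.
move=> r2; have cardX : #|X| = r + #|[set v : X | degree v == 1]|.
  rewrite -(cardsC (nonleaf X)) (card_nonleaf_spine spX); congr (_ + _).
  by apply: eq_card => v; rewrite !inE negbK.
rewrite cardX -addnA leq_add2l.
(* Double counting: a leaf hangs at only one position. *)
have leS : \sum_(i < r) size (leaves i) <= #|[set v : X | degree v == 1]|.
  rewrite -sum1_card (eq_bigr (fun i : 'I_r => \sum_(v in [set v : X | degree v == 1])
    (adj (sp i) v : nat))); last first.
    move=> i _; rewrite -big_mkcondr /= sum1_card -(card_uniqP (leaves_uniq i)).
    by apply: eq_card => v; rewrite mem_filter mem_enum andbT unfold_in /= inE.
  rewrite exchange_big /=; apply: leq_sum => v; rewrite inE => /eqP v1.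
  have lt := spine_pos_lt v.
  rewrite (bigD1 (Ordinal lt)) //= big1 ?addn0 ?leq_b1 // => i.
  by rewrite -val_eqE /= => /negbTE ne; rewrite leaf_adjE ?ne.
rewrite (eq_bigr _ (fun i _ => esym (size_leaves (ltn_ord i)))) big_split /=.
apply: leq_add => //.
apply: (@leq_trans (\sum_(i < r) ((i.+1 < r) + (0 < i)))).
  apply: leq_sum => i _.
  pose s := (if i.+1 < r then [:: i.+1] else [::]) ++ (if 0 < i then [:: i.-1] else [::]).
  have -> : (i.+1 < r) + (0 < i) = size s by rewrite size_cat; case: ifP; case: ifP.
  rewrite cardE -(size_map (@nat_of_ord r)); apply: uniq_leq_size.
    by rewrite (map_inj_uniq val_inj) enum_uniq.
  move=> x /mapP[j]; rewrite mem_enum inE => ij ->; rewrite /s mem_cat.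
  have ltj := ltn_ord j; case/orP: ij => /eqP E.
    by rewrite E ltj inE eqxx.
  by rewrite -E /= inE eqxx orbT.
have [t ->] : exists t, r = t.+2 by exists r.-2; lia.
rewrite big_split /= big_ord_recr /= ltnn addn0 [X in _ + X <= _]big_ord_recl /= add0n.
rewrite (eq_bigr (fun=> 1)); last by move=> i _; rewrite ltnS ltn_ord.
rewrite [X in _ + X <= _](eq_bigr (fun=> 1)) //.
by rewrite !sum_nat_const card_ord; lia.
Qed.

End Leaves.

(** Leaves at the same position are matched by rank in their lists; the default of [nth] is avoided
    once the leaf counts agree. *)
Definition spine_map (X Y : sgraph) (r : nat) (spX : nat -> X) (spY : nat -> Y) (v : X) : Y :=
  let i := spine_pos r spX v in
  if degree v == 1 then nth (spY i) (leaves spY i) (index v (leaves spX i)) else spY i.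

Section SpineMap.
Variables (X Y : sgraph) (r : nat) (sp : nat -> X) (sp' : nat -> Y).
Hypothesis spX : spine r sp.
Hypothesis spY : spine r sp'.
Hypothesis leafX : forall u v : X, adj u v -> degree u = 1 -> degree v != 1.
Hypothesis leafY : forall u v : Y, adj u v -> degree u = 1 -> degree v != 1.
Hypothesis degXY : forall i, i < r -> degree (sp i) = degree (sp' i).

Lemma size_leaves_eq (i : nat) : i < r -> size (leaves sp i) = size (leaves sp' i).
Proof.
move=> lti; have := degXY lti.
by rewrite -(size_leaves spX lti) -(size_leaves spY lti) => /addIn.
Qed.

Lemma spine_mapP (v : X) : let w := spine_map r sp sp' v in
  [/\ (degree w == 1) = (degree v == 1), spine_pos r sp' w = spine_pos r sp v
    & degree v = 1 -> index w (leaves sp' (spine_pos r sp v)) =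
                      index v (leaves sp (spine_pos r sp v))].
Proof.
rewrite /spine_map; set i := spine_pos r sp v.
have lti : i < r by apply: spine_pos_lt.
have [v1|vnl] /= := eqVneq (degree v) 1; last first.
  rewrite (negbTE (spine_nonleaf spY lti)) (spine_posE spY leafY lti).
  by split=> // v1; rewrite v1 in vnl.
set k := index v _; have ltk : k < size (leaves sp' i).
  by rewrite -size_leaves_eq // index_mem (mem_leaves spX leafX) // v1 !eqxx.
have := mem_nth (sp' i) ltk; rewrite (mem_leaves spY leafY) // => /andP[-> /eqP ->].
by split=> // _; rewrite index_uniq // leaves_uniq.
Qed.

End SpineMap.

Lemma spine_mapK (X Y : sgraph) (r : nat) (sp : nat -> X) (sp' : nat -> Y) :
  spine r sp -> spine r sp' ->
  (forall u v : X, adj u v -> degree u = 1 -> degree v != 1) ->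
  (forall u v : Y, adj u v -> degree u = 1 -> degree v != 1) ->
  (forall i, i < r -> degree (sp i) = degree (sp' i)) ->
  cancel (spine_map r sp sp') (spine_map r sp' sp).
Proof.
move=> spX spY leafX leafY degXY v.
have [deg pos idx] := spine_mapP spX spY leafX leafY degXY v.
move: deg pos idx; set w := spine_map r sp sp' v => deg pos idx.
rewrite /spine_map pos deg; case: eqP => [v1|/eqP vnl].
  rewrite idx // nth_index // (mem_leaves spX leafX) ?v1 ?eqxx //.
  exact: (spine_pos_lt spX leafX).
by rewrite -(spine_pos_nonleaf spX leafX vnl).
Qed.

(** [spine_map] preserves leaf status and position, which determine adjacency by [adj_spine_pos]. *)
Lemma spine_isomorphic (X Y : sgraph) (r : nat) (sp : nat -> X) (sp' : nat -> Y) :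
  spine r sp -> spine r sp' ->
  (forall u v : X, adj u v -> degree u = 1 -> degree v != 1) ->
  (forall u v : Y, adj u v -> degree u = 1 -> degree v != 1) ->
  (forall i, i < r -> degree (sp i) = degree (sp' i)) ->
  isomorphic X Y.
Proof.
move=> spX spY leafX leafY degXY; apply/isomorphicP; exists (spine_map r sp sp').
  exists (spine_map r sp' sp); first exact: spine_mapK.
  by apply: spine_mapK => // i /degXY.
move=> v w.
have [degv posv _] := spine_mapP spX spY leafX leafY degXY v.
have [degw posw _] := spine_mapP spX spY leafX leafY degXY w.
by rewrite (adj_spine_pos spY leafY) (adj_spine_pos spX leafX) degv posv degw posw.
Qed.

Lemma spine_rev (X : sgraph) (r : nat) (sp : nat -> X) :
  spine r sp -> spine r (fun i => sp (r - i.+1)).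
Proof.
move=> [a i n o]; split=> [s t lts ltt|s t lts ltt|s lts|v /o[s lts ->]].
- by rewrite a; lia.
- by move=> /i; lia.
- by apply: n; lia.
by exists (r - s.+1); [lia | congr sp; lia].
Qed.

(** * Caterpillars: spine and degree sequence *)

Local Open Scope nat_scope.

Lemma connected_degree_gt0 (X : sgraph) (v : X) :
  connected_graph X -> 1 < #|X| -> 0 < degree v.
Proof.
move=> [_ con] X2; have : 0 < #|[set~ v]| by rewrite cardsC1; lia.
case/card_gt0P => w; rewrite !inE => wv.
case/connectP: (con v w) => -[|u p] /=; first by move=> _ E; rewrite E eqxx in wv.
by move=> /andP[vu _] _; apply/card_gt0P; exists u; rewrite inE.
Qed.

(** Two adjacent leaves form a whole component. *)
Lemma connected_leaf_edge (X : sgraph) (u v : X) :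
  connected_graph X -> 2 < #|X| -> adj u v -> degree u = 1 -> degree v != 1.
Proof.
move=> [_ con] X3 uv u1; apply/eqP => v1.
have vu : adj v u by rewrite adj_sym.
have clo : closed (@adj X) [pred w in [:: u; v]].
  apply: intro_closed => [x y|x y xy]; first by rewrite !con.
  rewrite !inE => /orP[]/eqP E; subst x.
    by rewrite (leaf_neighbor u1 xy uv) eqxx orbT.
  by rewrite (leaf_neighbor v1 xy vu) eqxx.
have : #|X| <= #|[:: u; v]|.
  apply: subset_leq_card; apply/subsetP => w _.
  by have := closed_connect clo (con u w); rewrite !inE eqxx.
by have := card_size [:: u; v]; move: X3 => /=; lia.
Qed.

Lemma caterpillar_spine (X : sgraph) (k : nat) :
  0 < #|X| -> isomorphic (induced (nonleaf X)) (path_graph k) ->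
  exists sp : nat -> X, spine #|nonleaf X| sp.
Proof.
move=> /card_gt0P[x0 _] /isomorphicP[f [g fK gK] fadj].
have -> : #|nonleaf X| = k.
  rewrite -[k]card_ord -[LHS]card_sig; apply: bij_eq_card (_ : bijective f).
  by exists g.
pose sp i := if insub i is Some o then val (g o) else x0.
have spE i (lti : i < k) : sp i = val (g (Ordinal lti)) by rewrite /sp insubT.
exists sp; split=> [i j lti ltj|i j lti ltj|i lti|v vnl].
- rewrite !spE; have := fadj (g (Ordinal lti)) (g (Ordinal ltj)).
  by rewrite !gK /= /path_adj /induced_adj /= => ->.
- by rewrite !spE => /val_inj/(can_inj gK)[].
- by rewrite spE; have := valP (g (Ordinal lti)); rewrite inE.
have vin : v \in nonleaf X by rewrite inE.
have ltf := ltn_ord (f (exist _ v vin)).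
exists (f (exist _ v vin)) => //.
rewrite spE; have -> : Ordinal ltf = f (exist _ v vin) by apply: val_inj.
by rewrite fK.
Qed.

Lemma mem_nonleaf_degrees (X : sgraph) (v : X) :
  degree v != 1 -> degree v \in nonleaf_degrees X.
Proof.
by move=> vnl; rewrite mem_sort; apply: map_f; rewrite mem_enum inE.
Qed.

Lemma nonleaf_degrees_sorted (X : sgraph) : sorted geq (nonleaf_degrees X).
Proof. by apply: sort_sorted => m n; apply: leq_total. Qed.

Lemma size_nonleaf_degrees (X : sgraph) : size (nonleaf_degrees X) = #|nonleaf X|.
Proof. by rewrite size_sort size_map -cardE. Qed.

Lemma sumn_nonleaf_degrees (X : sgraph) (r : nat) (sp : nat -> X) :
  spine r sp -> sumn (nonleaf_degrees X) = \sum_(i < r) degree (sp i).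
Proof.
move=> spX; rewrite (perm_sumn (permEl (perm_sort _ _))) sumnE big_map big_enum /=.
have <- : [set sp i | i : 'I_r] = nonleaf X.
  apply/setP => v; rewrite inE; apply/imsetP/idP => [[i _ ->]|/(spine_onto spX)[i lti ->]].
    exact: (spine_nonleaf spX).
  by exists (Ordinal lti).
by rewrite big_imset //= => i j _ _ /(spine_inj spX) E; apply: val_inj; apply: E.
Qed.

Lemma leq_nonleaf_head (X : sgraph) (v : X) :
  degree v != 1 -> degree v <= nth 0 (nonleaf_degrees X) 0.
Proof.
move=> /mem_nonleaf_degrees; have := nonleaf_degrees_sorted X.
case: (nonleaf_degrees X) => //= a s; rewrite (path_sortedE (rev_trans leq_trans)).
by move=> /andP[/allP le _]; rewrite inE => /orP[/eqP ->|/le].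
Qed.

(** Sorting squeezes the second degree to d, the fourth is at least 3 and the others at least 2, so
    the sum is at least 3 d + 3 + 2 (r - 4). *)
Lemma leq_sumn_nonleaf_degrees (X : sgraph) (d : nat) :
  (forall v : X, 0 < degree v) ->
  nth 0 (nonleaf_degrees X) 0 = d -> nth 0 (nonleaf_degrees X) 2 = d ->
  2 < nth 0 (nonleaf_degrees X) 3 ->
  3 * d + 2 * #|nonleaf X| <= sumn (nonleaf_degrees X) + 5.
Proof.
move=> deg0 h0 h2 h3; rewrite -size_nonleaf_degrees.
have ge2 : all (leq 2) (nonleaf_degrees X).
  apply/allP => m; rewrite mem_sort => /mapP[v]; rewrite mem_enum inE => v1 ->.
  by have := deg0 v; lia.
have := nonleaf_degrees_sorted X; move: h0 h2 h3 ge2.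
case: (nonleaf_degrees X) => [|a [|b [|c [|e s]]]] //= -> -> lte.
move=> /and5P[_ _ _ _ ge2] /and4P[leb led _ _].
have : 2 * size s <= sumn s.
  by elim: s ge2 => //= m s IHs /andP[m2 /IHs]; lia.
move: leb led; rewrite /geq /=; lia.
Qed.

(** * The word of a spine and the reconstruction *)

Local Open Scope ring_scope.

(** The shift by 1 makes a letter vanish at a leaf, so a letter read at an end of a walk also serves
    as its non-leaf test. *)
Definition word (X : sgraph) (sp : nat -> X) (s : nat) : int := (degree (sp s))%:Z - 1.

Lemma spine_word_determined (G H : sgraph) (r d : nat) (sp : nat -> G) (sp' : nat -> H) :
  deck H =1 deck G -> degrees_within G d -> degrees_within H d ->
  spine r sp -> spine r sp' -> (0 < r)%N -> (3 < d)%N -> (r + 3 * d <= #|G| + 3)%N ->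
  (forall s, (s < r)%N -> word sp' s = word sp s) \/
  (forall s, (s < r)%N -> word sp' s = word sp (r - s.+1)%N).
Proof.
move=> E dG dH spG spH r0 d4 ler.
have sums k (fs : seq ('I_k.+1 * int)) (js : seq 'I_k.+1) p q :
    size fs = p -> size js = q -> (2 * (k.+1 + p + q * d.-1) <= #|G| + 2)%N ->
    \sum_(x : {ffun 'I_k.+1 -> G} | nb_pattern (pat x) &&
      all (fun j => degree (x j) != 1%N) js) wt fs x =
    \sum_(x : {ffun 'I_k.+1 -> H} | nb_pattern (pat x) &&
      all (fun j => degree (x j) != 1%N) js) wt fs x.
  by move=> <- <- le; apply: (sum_pat_nl _ E dG dH); rewrite card_ord.
have vertices (fs : seq ('I_1 * int)) : (ord0, 1) \in fs -> (size fs <= 2)%N ->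
    \sum_(s < r) \prod_(f <- fs) ((degree (sp s))%:Z - f.2) =
    \sum_(s < r) \prod_(f <- fs) ((degree (sp' s))%:Z - f.2).
  move=> m0 le2; rewrite -(sum_spine0 spG m0) -(sum_spine0 spH m0).
  apply: sum_pat => //; rewrite card_ord; apply: (@leq_trans (2 * 3)%N); last lia.
  by rewrite leq_mul2l leq_add2l.
apply: (@word_determined r r.-1./2 (word sp) (word sp') erefl r0).
- have := vertices [:: (ord0, 1)] (mem_head _ _) isT.
  by under eq_bigr do rewrite big_seq1; under [RHS]eq_bigr do rewrite big_seq1.
- have := vertices [:: (ord0, 1); (ord0, 1)] (mem_head _ _) isT.
  by under eq_bigr do rewrite big_cons big_seq1;
     under [RHS]eq_bigr do rewrite big_cons big_seq1.
- move=> k /andP[k0 lek]; have := @sums k [:: (ord_max, 1)] [:: ord0] 1%N 1%N erefl erefl.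
  rewrite (sum_spine spG k0) ?(sum_spine spH k0) ?inE ?eqxx ?orbT //.
  have linE (X : sgraph) (q : nat -> X) :
      \sum_(s < r - k) (\prod_(f <- [:: (ord_max, 1)])
          ((degree (q (s + (f : 'I_k.+1 * int).1)%N))%:Z - f.2) +
        \prod_(f <- [:: (ord_max, 1)])
          ((degree (q (s + (k - (f : 'I_k.+1 * int).1))%N))%:Z - f.2)) =
      lin_sum r k (word q).
    by apply: eq_bigr => s _; rewrite !big_seq1 /= subnn addn0.
  by rewrite !linE; apply; lia.
(* This is the dearest sum: k + 1 vertices, two letters and one test at the start make k + d + 2.
   With 2 k <= r - 1 and r + 3 d <= n + 3 this fits exactly because d >= 4. *)
- move=> j k /andP[k0 lek] lej; have ltj : (j < k.+1)%N by [].
  have := @sums k [:: (Ordinal ltj, 1); (ord_max, 1)] [:: ord0] 2%N 1%N erefl erefl.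
  rewrite (sum_spine spG k0) ?(sum_spine spH k0) ?inE ?eqxx ?orbT //.
  have quadE (X : sgraph) (q : nat -> X) :
      \sum_(s < r - k) (\prod_(f <- [:: (Ordinal ltj, 1); (ord_max, 1)])
          ((degree (q (s + (f : 'I_k.+1 * int).1)%N))%:Z - f.2) +
        \prod_(f <- [:: (Ordinal ltj, 1); (ord_max, 1)])
          ((degree (q (s + (k - (f : 'I_k.+1 * int).1))%N))%:Z - f.2)) =
      quad_sum r j k (word q).
    by apply: eq_bigr => s _; rewrite !big_cons !big_nil !mulr1 /= subnn addn0.
  by rewrite !quadE; apply; lia.
(* Both ends carry a letter, so no test is paid for; the two readings agree, whence the factor 2. *)
move=> k /andP[k0 lek]; have := @sums k [:: (ord0, 1); (ord_max, 1)] [::] 2%N 0%N erefl erefl.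
rewrite (sum_spine spG k0) ?(sum_spine spH k0) ?inE ?eqxx ?orbT //.
have autoE (X : sgraph) (q : nat -> X) :
    \sum_(s < r - k) (\prod_(f <- [:: (ord0, 1); (ord_max, 1)])
        ((degree (q (s + (f : 'I_k.+1 * int).1)%N))%:Z - f.2) +
      \prod_(f <- [:: (ord0, 1); (ord_max, 1)])
        ((degree (q (s + (k - (f : 'I_k.+1 * int).1))%N))%:Z - f.2)) =
    2 * auto_sum r k (word q).
  rewrite /auto_sum mulr_sumr; apply: eq_bigr => s _.
  by rewrite !big_cons !big_nil /= subnn subn0 !addn0 /word; ring.
by rewrite !autoE => S; apply: (@mulfI _ 2) => //; apply: S; lia.
Qed.

Local Close Scope ring_scope.

Theorem theorem6p5 (n r : nat) (G : sgraph)
  (n_ge48 : 48 <= n)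
  (card_G : #|G| = n)
  (cat_G : caterpillar G)
  (card_nonleaf : #|nonleaf G| = r)
  (r_ge : n <= 2 * r + 5)
  (d1_eq_d3 : nth 0 (nonleaf_degrees G) 0 = nth 0 (nonleaf_degrees G) 2)
  (d3_gt_d4 : nth 0 (nonleaf_degrees G) 3 < nth 0 (nonleaf_degrees G) 2)
  (d4_gt2 : 2 < nth 0 (nonleaf_degrees G) 3) :
  reconstructible G.
Proof.
move=> H E.
have n2 : 2 < #|G| by rewrite card_G; lia.
have [[conG _] [k pathG]] := cat_G.
have G0 (v : G) : 0 < degree v by apply: connected_degree_gt0 => //; lia.
have leafG (u v : G) : adj u v -> degree u = 1 -> degree v != 1.
  exact: connected_leaf_edge.
have [|sp] := caterpillar_spine _ pathG; first by lia.
rewrite card_nonleaf => spG.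
pose d := nth 0 (nonleaf_degrees G) 0.
have d4 : 3 < d by rewrite /d; lia.
have dG : degrees_within G d.
  move=> v; rewrite G0 /=; have [->|/leq_nonleaf_head //] := eqVneq (degree v) 1.
  by lia.
have r4 : 3 < r.
  rewrite -card_nonleaf -size_nonleaf_degrees ltnNge; apply/negP => le.
  by move: d4_gt2; rewrite nth_default.
have ler : r + 3 * d <= #|G| + 3.
  have := leq_card_spine spG leafG (ltnW (ltnW r4)).
  have := leq_sumn_nonleaf_degrees G0 (erefl d) (esym d1_eq_d3) d4_gt2.
  rewrite (sumn_nonleaf_degrees spG) card_nonleaf; lia.
have dH : degrees_within H d by apply: (degrees_within_eq E dG); lia.
have leafH (u v : H) : adj u v -> degree u = 1 -> degree v != 1.
  by apply: (no_leaf_edge E dG dH) leafG _ _; lia.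
have [sp' spH] : exists sp' : nat -> H, spine r sp'.
  by apply: (spine_transfer E dG dH spG); lia.
have r0 : 0 < r by lia.
have [eqw|eqw] := spine_word_determined E dG dH spG spH r0 d4 ler.
  apply: (spine_isomorphic spH spG leafH leafG) => s lts.
  by have := eqw s lts; rewrite /word; lia.
apply: (spine_isomorphic spH (spine_rev spG) leafH leafG) => s lts.
by have := eqw s lts; rewrite /word; lia.
Qed.
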